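(* Let $\mathfrak C$ be a small category that embeds in a discrete groupoid $\mathfrak G$. Then there is a canonical partial action of the universal group $\mathcal U(\mathfrak G)$ on $\Omega$ and canonical *-isomorphisms $$C^*_r(I_l\ltimes\Omega)\cong C_0(\Omega)\rtimes^r\mathcal U(\mathfrak G)\quad\text{and}\quad C^*_r(I_l\ltimes\partial\Omega)\cong C_0(\partial\Omega)\rtimes^r\mathcal U(\mathfrak G),$$ where $\rtimes^r$ denotes the reduced crossed product by the partial action (respectively its restriction to $\partial\Omega$).
   Context: A small category $\mathfrak C$ is identified with its set of morphisms and each object with its identity morphism; $\mathfrak d,\mathfrak t$ are the domain and target maps, and $cd$ is defined iff $\mathfrak d(c)=\mathfrak t(d)$. A category embedding in a groupoid is automatically cancellative. Put $\mathfrak d(c)\mathfrak C=\{x\in\mathfrak C:\mathfrak t(x)=\mathfrak d(c)\}$ and $c\mathfrak C=\{cx:x\in\mathfrak d(c)\mathfrak C\}$. Groupoid. Each $c\in\mathfrak C$ defines a partial bijection $\mathfrak d(c)\mathfrak C\to c\mathfrak C$, $x\mapsto cx$, also denoted $c$. $I_l$ is the inverse semigroup of partial bijections of $\mathfrak C$ generated by these, so $I_l=\{d_1^{-1}c_1\cdots d_n^{-1}c_n:c_i,d_i\in\mathfrak C,n\ge1\}$; $0$ is the empty function and $I_l^\times=I_l\setminus\{0\}$; $\mathrm{dom}(s),\mathrm{im}(s)$ are the domain and image of $s\in I_l$. $\mathcal J=\{\mathrm{dom}(s):s\in I_l\}$, $\mathcal J^\times$ its nonempty members. A character on $\mathcal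 J$ is a nonzero map $\chi\colon\mathcal J\to\{0,1\}$ with $\chi(X\cap Y)=\chi(X)\chi(Y)$ and $\chi(\emptyset)=0$ if $\emptyset\in\mathcal J$. $\Omega\subseteq\{0,1\}^{\mathcal J}$ (subspace topology) is the space of characters such that whenever $X,X_1,\dots,X_n\in\mathcal J^\times$ and $X=\bigcup_iX_i$, $\chi(X)=1$ implies $\chi(X_i)=1$ for some $i$. A character $\chi$ is maximal if $\chi^{-1}(1)$ is maximal under inclusion among the sets $\gamma^{-1}(1)$, $\gamma$ a character; maximal characters lie in $\Omega$, and $\partial\Omega$ is the closure in $\Omega$ of the set of maximal characters. Put $\Omega(X)=\{\chi\in\Omega:\chi(X)=1\}$. For $s\in I_l$ and $\chi\in\Omega(\mathrm{dom}(s))$ set $(s.\chi)(X)=\chi(s^{-1}(X\cap\mathrm{im}(s)))$. $I_l\ltimes\Omega$ is the set of classes $[s,\chi]$ of pairs with $s\in I_l$, $\chi\in\Omega(\mathrm{dom}(s))$, where $(s,\chi)\sim(t,\chi)$ iff there is $X\in\mathcal J$ with $\chi(X)=1$ and $s(x)=t(x)$ for all $x\in X$; operations $[s,t.\chi][t,\chi]=[st,\chi]$, $[s,\chi]^{-1}=[s^{-1},s.\chi]$; source $\chi$, range $s.\chi$; topology generated by the sets $[s,U]=\{[s,\chi]:\chi\in U\}$, $U\subseteq\Omega(\mathrm{dom}(s))$ compact open. It is a locally compact étale groupoid with unit space $\Omega$ (Hausdorff in the present case); $\partial\Omega$ is closed and invariant, and $I_l\ltimes\partial\Omega$ is the restriction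 to $\partial\Omega$. $C^*_r$ is the reduced groupoid C*-algebra. Universal group. $j_{\mathfrak G}\colon\mathfrak G\to\mathcal U(\mathfrak G)$ is the functor to a group such that every functor $\mu\colon\mathfrak G\to H$ to a group factors as $\mu'\circ j_{\mathfrak G}$ for a (unique) group homomorphism $\mu'$. Let $\rho\colon\mathfrak C\to\mathfrak G$ be the embedding. There is a well-defined map $\bar\rho\colon I_l^\times\to\mathcal U(\mathfrak G)$ with $\bar\rho(d_1^{-1}c_1\cdots d_n^{-1}c_n)=j_{\mathfrak G}\big(\rho(d_1)^{-1}\rho(c_1)\cdots\rho(d_n)^{-1}\rho(c_n)\big)$, satisfying $\bar\rho(st)=\bar\rho(s)\bar\rho(t)$ whenever $st\neq0$. The canonical partial action of $\mathcal U(\mathfrak G)$ on $\Omega$ is: $g\in\mathcal U(\mathfrak G)$ has domain $\bigcup_{s\in\bar\rho^{-1}(g)}\Omega(\mathrm{dom}(s))$, and $g.\chi=s.\chi$ for any $s\in\bar\rho^{-1}(g)$ with $\chi(\mathrm{dom}(s))=1$. The canonical *-isomorphisms are those induced by the isomorphism of topological groupoids $[s,\chi]\mapsto(\bar\rho(s),\chi)$ onto the transformation groupoid $\mathcal U(\mathfrak G)\ltimes\Omega=\{(g,\chi):\chi\in\text{domain of }g\}$ of the partial action (source $\chi$, range $g.\chi$), and by its restriction to $\partial\Omega$. *)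

(* Defs.v *)
From HB Require Import structures.
From mathcomp Require Import all_boot all_order all_algebra.
From mathcomp Require Import all_classical all_reals all_analysis.
From mathcomp Require Import summability.
From mathcomp Require Import complex.
From mathcomp Require Import lra.

Set Implicit Arguments.
Unset Strict Implicit.
Unset Printing Implicit Defensive.
Import Order.TTheory GRing.Theory Num.Theory.
Import numFieldNormedType.Exports.

Local Open Scope classical_set_scope.
Local Open Scope ring_scope.

(* A small category is its set of morphisms, objects being the identity
   morphisms.  [ccomp c d] is the product [cd]; it is meaningful only when
   [cdom c = ctgt d], and nothing is assumed about its value otherwise. *)
Record category := Category {
  mor :> Type;
  cdom : mor -> mor;
  ctgt : mor -> mor;
  ccomp : mor -> mor -> mor;
  cdom_dom : forall c, cdom (cdom c) = cdom c;
  ctgt_dom : forall c, ctgt (cdom c) = cdom c;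
  cdom_tgt : forall c, cdom (ctgt c) = ctgt c;
  ctgt_tgt : forall c, ctgt (ctgt c) = ctgt c;
  cdom_comp : forall c d, cdom c = ctgt d -> cdom (ccomp c d) = cdom d;
  ctgt_comp : forall c d, cdom c = ctgt d -> ctgt (ccomp c d) = ctgt c;
  ccomp_dom : forall c, ccomp c (cdom c) = c;
  ccomp_tgt : forall c, ccomp (ctgt c) c = c;
  ccompA : forall c d e, cdom c = ctgt d -> cdom d = ctgt e ->
    ccomp c (ccomp d e) = ccomp (ccomp c d) e
}.
Arguments cdom {c} : rename.
Arguments ctgt {c} : rename.
Arguments ccomp {c} : rename.

Record groupoid := Groupoid {
  gcat :> category;
  ginv : gcat -> gcat;
  gdom_inv : forall g, cdom (ginv g) = ctgt g;
  gtgt_inv : forall g, ctgt (ginv g) = cdom g;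
  gmulVg : forall g, ccomp (ginv g) g = cdom g;
  gmulgV : forall g, ccomp g (ginv g) = ctgt g
}.
Arguments ginv {g} : rename.

Definition is_functor (C D : category) (F : C -> D) : Prop :=
  [/\ forall c, cdom (F c) = F (cdom c),
      forall c, ctgt (F c) = F (ctgt c)
    & forall c d, cdom c = ctgt d -> F (ccomp c d) = ccomp (F c) (F d)].

Definition is_embedding (C D : category) (F : C -> D) : Prop :=
  is_functor F /\ injective F.

(* Functors to a group, viewed as a category with one object; identities are
   then automatically sent to 1. *)
Definition is_functor_to_group (C : category) (H : groupType) (mu : C -> H) :=
  forall c d, cdom c = ctgt d -> mu (ccomp c d) = (mu c * mu d)%g.

Definition is_universal_group (G : groupoid) (U : groupType) (j : G -> U) :=
  is_functor_to_group j /\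
  forall (H : groupType) (mu : G -> H), is_functor_to_group mu ->
    exists! mu' : U -> H,
      {morph mu' : x y / (x * y)%g} /\ forall g, mu g = mu' (j g).

(* A partial map [s] on [T] is its graph, a set of pairs [(x, s(x))].  With the
   notations of [relation_scope], [(s \; t)%relation] is "[t] first, then [s]",
   i.e. the product [st], and [(s^-1)%relation] is the inverse. *)
Section Graphs.
Variables T : Type.
Implicit Types (s : set (T * T)) (X : set T).

Definition pdom s : set T := [set x | exists y, s (x, y)].
Definition pim s : set T := [set y | exists x, s (x, y)].
(* [s^-1 (X `&` pim s)] *)
Definition ppreim s X : set T := [set x | exists2 y, X y & s (x, y)].

End Graphs.

Section Spectrum.
Variable C : category.
Implicit Types (s t : set (C * C)) (X : set C).

Definition lmul (c : C) : set (C * C) :=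
  [set xy | ctgt xy.1 = cdom c /\ xy.2 = ccomp c xy.1].

Inductive Il : set (C * C) -> Prop :=
| Il_lmul c : Il (lmul c)
| Il_inv s : Il s -> Il (s^-1)%relation
| Il_mul s t : Il s -> Il t -> Il (s \; t)%relation.

(* [zigzag (d1, c1) [:: (d2, c2); ...]] is [d1^-1 c1 d2^-1 c2 ...]. *)
Fixpoint zigzag (p : C * C) (w : seq (C * C)) : set (C * C) :=
  let dc := ((lmul p.1)^-1 \; lmul p.2)%relation in
  if w is q :: w' then (dc \; zigzag q w')%relation else dc.

Definition Jset : set (set C) := [set X | exists2 s, Il s & X = pdom s].

Definition cube : Type := prod_topology (fun _ : Jset => bool).
HB.instance Definition _ := Topological.on cube.
Implicit Types chi : cube.

(* [supp chi] is chi^-1(1), as a set of subsets of C. *)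
Definition supp chi : set (set C) :=
  [set X | exists2 Y : Jset, set_val Y = X & chi Y].

Definition is_character chi : Prop :=
  [/\ exists X : Jset, chi X,
      forall X Y : Jset, supp chi (set_val X `&` set_val Y) <-> chi X && chi Y
    & ~ supp chi set0].

Definition is_maximal chi : Prop :=
  is_character chi /\
  forall gamma : cube, is_character gamma ->
    supp chi `<=` supp gamma -> supp gamma = supp chi.

Definition Omega_set : set cube :=
  [set chi | is_character chi /\
    forall (X : Jset) (n : nat) (F : 'I_n -> Jset),
      set_val X !=set0 -> (forall i, set_val (F i) !=set0) ->
      set_val X = \bigcup_i set_val (F i) ->
      chi X -> exists i, chi (F i)].

(* [set_type] carries the subspace topology. *)
Definition Omega : Type := set_type Omega_set.
HB.instance Definition _ := Topological.on Omega.

Definition Omega_at (X : set C) : set Omega := [set chi | supp (set_val chi) X].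

Definition bdOmega : set Omega := closure [set chi | is_maximal (set_val chi)].

(* (s.chi)(X) = chi(s^-1(X `&` im s)) *)
Definition act s chi : cube :=
  fun X : Jset => `[< supp chi (ppreim s (set_val X)) >].

Definition germ_eq (chi : Omega) s t : Prop :=
  exists2 X, supp (set_val chi) X &
    forall x, X x -> exists y, s (x, y) /\ t (x, y).

Definition germ_class (chi : Omega) s : set (set (C * C)) :=
  [set t | [/\ Il t, Omega_at (pdom t) chi & germ_eq chi s t]].

(* The germ [s, chi] is encoded as the pair of [chi] and of the set of all [t]
   with (t, chi) ~ (s, chi). *)
Definition germ : Type :=
  set_type [set a : Omega * set (set (C * C)) |
    exists s, [/\ Il s, Omega_at (pdom s) a.1 & a.2 = germ_class a.1 s]].
HB.instance Definition _ := Choice.on germ.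

(* [is_germ s chi a] : a = [s, chi] *)
Definition is_germ s (chi : Omega) (a : germ) : Prop :=
  [/\ Il s, Omega_at (pdom s) chi & set_val a = (chi, germ_class chi s)].

Definition germ_subbase_index : set (set (C * C) * set Omega) :=
  [set sU | [/\ Il sU.1, open sU.2, compact sU.2
              & sU.2 `<=` Omega_at (pdom sU.1)]].

Definition germ_subbase (sU : set (C * C) * set Omega) : set germ :=
  [set a | exists2 chi, sU.2 chi & is_germ sU.1 chi a].

HB.instance Definition _ :=
  isSubBaseTopological.Build germ germ_subbase_index germ_subbase.

End Spectrum.
Arguments bdOmega C : clear implicits.

Section RhoBar.
Variables (C : category) (G : groupoid) (rho : C -> G).
Variables (U : groupType) (j : G -> U).

(* rho(d1)^-1 rho(c1) rho(d2)^-1 rho(c2) ... in G *)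
Fixpoint gzigzag (p : C * C) (w : seq (C * C)) : G :=
  let dc := ccomp (ginv (rho p.1)) (rho p.2) in
  if w is q :: w' then ccomp dc (gzigzag q w') else dc.

(* Only the values of [rb] on I_l^x are constrained. *)
Definition is_rhobar (rb : set (C * C) -> U) : Prop :=
  (forall p w, zigzag p w <> set0 -> rb (zigzag p w) = j (gzigzag p w)) /\
  (forall s t, Il s -> Il t -> (s \; t)%relation <> set0 ->
     rb (s \; t)%relation = (rb s * rb t)%g).

End RhoBar.

(* Only the data entering the reduced C*-algebra are recorded.  Source, range
   and product are given by their graphs: [gsrc a x] says that x is the source
   of a, and [gmul a b c] that ab is defined and equal to c. *)
Record topGroupoid (X : Type) := TopGroupoid {
  arrow :> topologicalType;
  gsrc : arrow -> set X;
  grng : arrow -> set X;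
  gmul : arrow -> arrow -> set arrow
}.
Arguments gsrc {X t} : rename.
Arguments grng {X t} : rename.
Arguments gmul {X t} : rename.

Definition is_groupoid_iso (X : Type) (G H : topGroupoid X) (F : G -> H) :=
  [/\ continuous F,
      exists F', [/\ cancel F F', cancel F' F & continuous F'],
      forall a x, gsrc (F a) x <-> gsrc a x,
      forall a x, grng (F a) x <-> grng a x
    & forall a b c, gmul (F a) (F b) (F c) <-> gmul a b c].

Definition groupoid_restrict (X : Type) (G : topGroupoid X) (Y : set X) :
    topGroupoid Y :=
  @TopGroupoid Y
    (set_type [set a : G | (exists2 x, Y x & gsrc a x) /\
                           (exists2 x, Y x & grng a x)])
    (fun a y => gsrc (set_val a) (set_val y))
    (fun a y => grng (set_val a) (set_val y))
    (fun a b c => gmul (set_val a) (set_val b) (set_val c)).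

Arguments groupoid_restrict {X} G Y.

Definition germ_groupoid (C : category) : topGroupoid (Omega C) :=
  @TopGroupoid (Omega C) (germ C)
    (fun a chi => exists s, is_germ s chi a)
    (fun a psi => exists s chi, is_germ s chi a /\
       set_val psi = act s (set_val chi))
    (fun a b c => exists s t chi (psi : Omega C),
       [/\ is_germ t chi b, set_val psi = act t (set_val chi),
           is_germ s psi a & is_germ (s \; t)%relation chi c]).

Section PartialAction.
Variables (U : groupType) (X : topologicalType).

(* [theta g] is the graph of the partial homeomorphism of g, so that
   [theta g (x, y)] says that g.x is defined and equal to y. *)
Definition is_partial_action (theta : U -> set (X * X)) : Prop :=
  [/\ forall g x y z, theta g (x, y) -> theta g (x, z) -> y = z,
      theta 1%g = [set p | p.1 = p.2],
      forall g, theta (g^-1)%g = ((theta g)^-1)%relation,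
      forall g h, (theta g \; theta h)%relation `<=` theta (g * h)%g
    & (forall g, open (pdom (theta g))) /\
      (forall g (V : set X), open V -> open (ppreim (theta g) V))].

Definition transformation_arrow (theta : U -> set (X * X)) : Type :=
  set_type [set p : discrete_topology U * X | pdom (theta p.1) p.2].
HB.instance Definition _ theta := Topological.on (transformation_arrow theta).

Definition transformation_groupoid (theta : U -> set (X * X)) : topGroupoid X :=
  @TopGroupoid X (transformation_arrow theta)
    (fun a x => x = (set_val a).2)
    (fun a y => theta (set_val a).1 ((set_val a).2, y))
    (fun a b c => theta (set_val b).1 ((set_val b).2, (set_val a).2) /\
       set_val c = (((set_val a).1 * (set_val b).1)%g, (set_val b).2)).

Definition restrict_action (theta : U -> set (X * X)) (Y : set X) :
    U -> set (Y * Y) :=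
  fun g => [set p | theta g (set_val p.1, set_val p.2)].

End PartialAction.
Arguments restrict_action {U X} theta Y _.

Definition is_canonical_action (C : category) (U : groupType)
    (rb : set (C * C) -> U) (theta : U -> set (Omega C * Omega C)) : Prop :=
  [/\ is_partial_action theta,
      forall g, pdom (theta g) =
        \bigcup_(s in [set s | [/\ Il s, s <> set0 & rb s = g]])
          Omega_at (pdom s)
    & forall s chi psi, Il s -> s <> set0 -> Omega_at (pdom s) chi ->
        theta (rb s) (chi, psi) -> set_val psi = act s (set_val chi)].

Section L2.
Variables (R : realType) (I : choiceType).

(* [^o] selects the topology of the complex field. *)
Definition sqnorm (xi : I -> R[i]^o) : \bar R :=
  (\esum_(i in [set: I]) ((Normc.normc (xi i)) ^+ 2)%:E)%E.

Definition l2 : {pred I -> R[i]^o} :=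
  [pred xi : I -> R[i]^o | `[< (sqnorm xi < +oo)%E >]].

Lemma sqnormD (xi eta : I -> R[i]^o) :
  (sqnorm (xi + eta)%R <= sqnorm xi + sqnorm xi + (sqnorm eta + sqnorm eta))%E.
Proof.
have ge0 (z : I -> R[i]^o) i : [set: I] i ->
    (0 <= ((Normc.normc (z i)) ^+ 2)%:E)%E.
  by move=> _; rewrite lee_fin sqr_ge0.
have dge0 (z : I -> R[i]^o) i : [set: I] i ->
    (0 <= ((Normc.normc (z i)) ^+ 2)%:E + ((Normc.normc (z i)) ^+ 2)%:E)%E.
  by move=> Ii; rewrite adde_ge0// ge0.
rewrite /sqnorm -!esumD//; try by [apply: ge0|apply: dge0].
apply: le_esum => i _; rewrite -!EFinD lee_fin.
have /= := le_normcD (xi i) (eta i).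
have nge0 (z : R[i]) : 0 <= Normc.normc z by case: z => a b; exact: sqrtr_ge0.
move: (nge0 (xi i + eta i)) (nge0 (xi i)) (nge0 (eta i)).
rewrite -[(xi + eta) i]/(xi i + eta i).
move: (Normc.normc (xi i + eta i)) (Normc.normc (xi i)) (Normc.normc (eta i)).
move=> c a b c0 a0 b0 cab; apply: (@le_trans _ _ ((a + b) ^+ 2)).
  by rewrite ler_pXn2r// nnegrE addr_ge0.
have := sqr_ge0 (a - b); rewrite sqrrB sqrrD; lra.
Qed.

Lemma l2_submod_closed : submod_closed l2.
Proof.
split=> [|a xi eta].
  apply/asboolP; rewrite /sqnorm esum1// => i _.
  by rewrite Normc.normc0 expr0n.
move=> /asboolP hxi /asboolP heta; apply/asboolP.
suff haxi : (sqnorm (a *: xi)%R < +oo)%E.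
  by apply: (le_lt_trans (sqnormD (a *: xi) eta)); rewrite !lte_add_pinfty.
have : (sqnorm (a *: xi)%R <= (Normc.normc a ^+ 2)%:E * sqnorm xi)%E.
  apply: ge_ereal_sup => _ [A [finA _] <-].
  under eq_fsbigr do rewrite Normc.normcM exprMn EFinM.
  rewrite -ge0_mule_fsumr; last by move=> i; rewrite lee_fin sqr_ge0.
  by rewrite lee_wpmul2l ?lee_fin ?sqr_ge0//; apply: ereal_sup_ubound; exists A.
move=> /le_lt_trans; apply; apply: lte_mul_pinfty => //.
by rewrite lee_fin sqr_ge0.
Qed.

HB.instance Definition _ :=
  GRing.isSubmodClosed.Build R[i] (I -> R[i]^o) l2 l2_submod_closed.

Record L2 : Type := MkL2 { L2_val :> I -> R[i]^o; L2P : L2_val \in l2 }.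

HB.instance Definition _ := [isSub for L2_val].
HB.instance Definition _ := [Choice of L2 by <:].
HB.instance Definition _ := [SubChoice_isSubLmodule of L2 by <:].

Definition l2norm (xi : L2) : R := Num.sqrt (fine (sqnorm xi)).

(* sum of the [xi i * conj (eta i)], as a limit over the finite subsets of I *)
Definition inner (xi eta : L2) : R[i]^o :=
  lim (partial_sum (fun i => xi i * (eta i)^*%C : R[i]^o) @ totally).

Definition opnorm_le (T : L2 -> L2) (M : R) : Prop :=
  forall xi, l2norm (T xi) <= M * l2norm xi.

Definition bounded_operator (T : L2 -> L2) : Prop :=
  linear T /\ exists M, opnorm_le T M.

Definition is_adjoint (T T' : L2 -> L2) : Prop :=
  forall xi eta, inner (T xi) eta = inner xi (T' eta).

Definition op_closure (A : set (L2 -> L2)) : set (L2 -> L2) :=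
  [set T | bounded_operator T /\
    forall e : R, 0 < e -> exists2 S, A S & opnorm_le (fun xi => T xi - S xi) e].

(* The vector of L2 with the given coordinates; 0 if these are not
   square-summable. *)
Definition toL2 (xi : I -> R[i]^o) : L2 := insubd 0 xi.

End L2.

(* [phi] restricts to a *-isomorphism from A onto B, for A and B *-subalgebras
   of B(l^2(I)) and B(l^2(K)); its values outside A are irrelevant. *)
Definition is_star_iso (R : realType) (I K : choiceType)
    (A : set (L2 R I -> L2 R I)) (B : set (L2 R K -> L2 R K))
    (phi : (L2 R I -> L2 R I) -> (L2 R K -> L2 R K)) : Prop :=
  [/\ set_bij A B phi,
      forall (a : R[i]) S T, A S -> A T ->
        phi (fun xi => a *: S xi + T xi) = (fun xi => a *: phi S xi + phi T xi),
      forall S T, A S -> A T -> phi (S \o T) = phi S \o phi T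
    & forall S S', A S -> A S' -> is_adjoint S S' ->
        is_adjoint (phi S) (phi S')].

Section ReducedGroupoid.
Variables (R : realType) (X : Type) (G : topGroupoid X).

Definition Cc : set (G -> R[i]^o) :=
  [set f : G -> R[i]^o | continuous f /\ compact (closure [set a | f a != 0])].

(* (f * xi)(c) = \sum_(ab = c) f(a) xi(b).  For an etale Hausdorff groupoid and f
   in [Cc], only finitely many terms of the sum are nonzero and the result is
   square-summable for xi in l^2. *)
Definition convolution (f xi : G -> R[i]^o) : G -> R[i]^o :=
  fun c => \sum_(ab \in [set ab : G * G | gmul ab.1 ab.2 c]) f ab.1 * xi ab.2.

(* The direct sum over all units x of the regular representations of [Cc] on
   l^2(G_x), which is a representation on l^2(G) as G is the disjoint union of
   the source fibres G_x. *)
Definition regular_rep (f : G -> R[i]^o) : L2 R G -> L2 R G :=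
  fun xi => toL2 (convolution f xi).

(* The reduced norm of f is the operator norm of [regular_rep f], so the
   completion of [Cc] is the norm closure of its image. *)
Definition Cstar_r : set (L2 R G -> L2 R G) :=
  op_closure [set regular_rep f | f in Cc].

End ReducedGroupoid.

Section ReducedCrossedProduct.
Variables (R : realType) (U : groupType) (X : topologicalType).
Variable theta : U -> set (X * X).

Definition C0 : set (X -> R[i]^o) :=
  [set f : X -> R[i]^o | continuous f /\
    forall e : R, 0 < e -> exists2 K, compact K &
      forall x, ~ K x -> Normc.normc (f x) < e].

(* The algebraic crossed product: finite sums of [a_g delta_g], with a_g in the
   ideal C_0(im(theta_g)) of C_0(X). *)
Definition algebraic_crossed_product : set (U -> X -> R[i]^o) :=
  [set a | finite_set [set g | a g != 0] /\
    forall g, C0 (a g) /\ forall y, ~ pim (theta g) y -> a g y = 0].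

(* The regular representation on l^2(X) (x) l^2(U), induced by the faithful
   representation of C_0(X) on l^2(X) by multiplication operators:
   (a xi)(x, k) = \sum_g a_g(k.x) xi(x, g^-1 k), and 0 if k.x is undefined. *)
Definition crossed_formula (a : U -> X -> R[i]^o) (xi : X * U -> R[i]^o) :
    X * U -> R[i]^o :=
  fun xk => \sum_(gy \in [set gy : U * X | theta xk.2 (xk.1, gy.2)])
    a gy.1 gy.2 * xi (xk.1, (gy.1^-1 * xk.2)%g).

Definition crossed_rep (a : U -> X -> R[i]^o) :
    L2 R (X * U)%type -> L2 R (X * U)%type :=
  fun xi => toL2 (crossed_formula a xi).

Definition crossed_product_r : set (L2 R (X * U)%type -> L2 R (X * U)%type) :=
  op_closure [set crossed_rep a | a in algebraic_crossed_product].

(* The element \sum_g f(g, g^-1.y) delta_g attached to a function f on the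
   transformation groupoid; the sum below has at most one term. *)
Definition crossed_coef (f : transformation_groupoid theta -> R[i]^o) :
    U -> X -> R[i]^o :=
  fun g y => \sum_(p \in [set p : transformation_groupoid theta |
      (set_val p).1 = g /\ theta g ((set_val p).2, y)]) f p.

(* [F] induces a *-isomorphism of the reduced C*-algebra of G onto the reduced
   crossed product. *)
Definition induces_star_iso (G : topGroupoid X)
    (F : G -> transformation_groupoid theta) : Prop :=
  exists2 phi, is_star_iso (@Cstar_r R X G) crossed_product_r phi &
    forall f, Cc f -> phi (regular_rep (f \o F)) = crossed_rep (crossed_coef f).

End ReducedCrossedProduct.

(* Main.v *)
Require Import Defs.
From HB Require Import structures.
From mathcomp Require Import all_boot all_order all_algebra.
From mathcomp Require Import all_classical all_reals all_analysis.
From mathcomp Require Import perm finmap summability complex lra.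

(* An element s of I_l is the restriction of a left translation of the groupoid,
   so it is determined on its domain by the value rb(s) in the universal group:
   two arrows with the same source and the same image in U(G) coincide, since
   only identities of G become trivial in U(G). Hence germs [s, chi] correspond
   to pairs (rb(s), chi), and Omega has enough compact open sets for this to be
   a homeomorphism onto the transformation groupoid T of the action.

   T sits inside Omega x U(G) as the set of pairs (x, k) with k.x defined. The
   regular representation of the crossed product on l^2(Omega x U(G)) vanishes
   off T and is the regular representation of T on l^2(T), so compression to a
   corner matches the two completions. A coefficient in C_0(im(theta_g)) is
   approximated uniformly by one with compact support in im(theta_g), which
   gives the density needed for surjectivity. Everything restricts to closed
   invariant sets, in particular to the boundary. *)

Set Implicit Arguments.
Unset Strict Implicit.
Unset Printing Implicit Defensive.
Import Order.TTheory GRing.Theory Num.Theory.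
Import numFieldNormedType.Exports.

Local Open Scope classical_set_scope.
Local Open Scope ring_scope.

(** * The universal group of a groupoid *)

(** The universal group is given only by its universal property, so an element of it is shown to be
    nontrivial by exhibiting a functor to some group that detects it. Injectivity can be expected
    only among arrows with a common source, since all identities become 1; this is enough because
    left translations preserve sources.

    The two completions act on different Hilbert spaces, and [T] is in general a proper part of
    Omega x U(G), so no unitary relates them. The isomorphism is instead S -> V S V^* with V the
    isometry extending by zero. A generator of the crossed product need not be such a compression of
    a generator, because its coefficients need not have compact support; hence generators are
    compared only up to norm approximation, and surjectivity is obtained by compressing limits.
    Since only closures matter, the norm estimates need constants that depend on nothing but the
    finite set of group elements involved. *)

Section GroupoidArrows.
Variable G : groupoid.
Implicit Types (a b c : G) (u v w : G).

(** Composition is unspecified off composable pairs; a predicate carrying both ends of an arrow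
    discharges the composability conditions by unification. *)
Definition garrow u v a := cdom a = u /\ ctgt a = v.

Lemma garrowE a : garrow (cdom a) (ctgt a) a.
Proof. by []. Qed.

Lemma garrow_comp u v w a b : garrow v w a -> garrow u v b ->
  garrow u w (ccomp a b).
Proof.
by move=> [av aw] [bu bv]; split; rewrite ?cdom_comp ?ctgt_comp ?av.
Qed.

Lemma garrow_inv u v a : garrow u v a -> garrow v u (ginv a).
Proof. by move=> [au av]; split; rewrite ?gdom_inv ?gtgt_inv. Qed.

Lemma garrow_id u v a : garrow u v a -> garrow u u u /\ garrow v v v.
Proof.
by move=> [<- <-]; rewrite /garrow !cdom_dom !ctgt_dom !ctgt_tgt !cdom_tgt.
Qed.

Lemma garrow_compA u v w x a b c : garrow w x a -> garrow v w b ->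
  garrow u v c -> ccomp a (ccomp b c) = ccomp (ccomp a b) c.
Proof. by move=> [aw _] [bv bw] [_ cv]; rewrite ccompA ?aw ?bv. Qed.

Lemma garrow_mul1 u v a : garrow u v a -> ccomp v a = a.
Proof. by move=> [_ <-]; exact: ccomp_tgt. Qed.

Lemma garrow_1mul u v a : garrow u v a -> ccomp a u = a.
Proof. by move=> [<- _]; exact: ccomp_dom. Qed.

Lemma garrow_mulV u v a : garrow u v a -> ccomp a (ginv a) = v.
Proof. by move=> [_ <-]; exact: gmulgV. Qed.

Lemma garrow_Vmul u v a : garrow u v a -> ccomp (ginv a) a = u.
Proof. by move=> [<- _]; exact: gmulVg. Qed.

Lemma garrow_KV u v w a b : garrow w v a -> garrow u v b ->
  ccomp a (ccomp (ginv a) b) = b.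
Proof.
move=> ha hb; rewrite (garrow_compA ha (garrow_inv ha) hb).
by rewrite (garrow_mulV ha) (garrow_mul1 hb).
Qed.


(** The isotropy group at the source of [g]. [{classic G}] supplies the choice structure that a
    [groupType] requires. *)
Definition vertex (g : G) : Type :=
  {x : {classic G} | `[< garrow (cdom g) (cdom g) x >]}.

End GroupoidArrows.

Section VertexGroup.
Variables (G : groupoid) (g : G).
Local Notation V := (vertex g).
Local Notation u := (cdom g).

HB.instance Definition _ := Choice.on V.

Lemma vertexP (x : V) : garrow u u (val x : G).
Proof. exact/asboolP/(valP x). Qed.

Definition Vertex (x : G) (ux : garrow u u x) : V :=
  exist _ (x : {classic G}) (asboolT ux).

Definition vertex_one : V :=
  @Vertex u (proj1 (garrow_id (garrowE g))).
Definition vertex_mul (x y : V) : V :=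
  Vertex (garrow_comp (vertexP x) (vertexP y)).
Definition vertex_inv (x : V) : V :=
  Vertex (garrow_inv (vertexP x)).

Lemma vertex_mulA : associative vertex_mul.
Proof.
move=> x y z; apply: val_inj.
exact: garrow_compA (vertexP x) (vertexP y) (vertexP z).
Qed.
Lemma vertex_mul1 : left_id vertex_one vertex_mul.
Proof. by move=> x; apply: val_inj; exact: garrow_mul1 (vertexP x). Qed.
Lemma vertex_1mul : right_id vertex_one vertex_mul.
Proof. by move=> x; apply: val_inj; exact: garrow_1mul (vertexP x). Qed.
Lemma vertex_mulV : left_inverse vertex_one vertex_inv vertex_mul.
Proof. by move=> x; apply: val_inj; exact: garrow_Vmul (vertexP x). Qed.
Lemma vertex_Vmul : right_inverse vertex_one vertex_inv vertex_mul.
Proof. by move=> x; apply: val_inj; exact: garrow_mulV (vertexP x). Qed.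

HB.instance Definition _ := isGroup.Build V vertex_mulA vertex_mul1 vertex_1mul
  vertex_mulV vertex_Vmul.

Definition connected_to_base (v : G) := exists t, garrow u v t.

Lemma connected_to_base_iff v w x : garrow v w x ->
  connected_to_base v <-> connected_to_base w.
Proof.
move=> hx; split=> [[t ht]|[t ht]].
  by exists (ccomp x t); exact: garrow_comp hx ht.
by exists (ccomp (ginv x) t); exact: garrow_comp (garrow_inv hx) ht.
Qed.

(* A choice of arrow from the base vertex to every vertex of its component turns
   the component into the product of the vertex group and a pair groupoid. *)
Definition transversal (v : G) : G :=
  if pselect (connected_to_base v) is left e then projT1 (cid e) else u.

Lemma transversalP v : connected_to_base v -> garrow u v (transversal v).
Proof. by rewrite /transversal; case: pselect => // e _; case: cid. Qed.

Lemma retraction_subproof (x : G) (e : connected_to_base (cdom x)) :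
  garrow u u (ccomp (ginv (transversal (ctgt x)))
                    (ccomp x (transversal (cdom x)))).
Proof.
have /transversalP et := iffLR (connected_to_base_iff (garrowE x)) e.
apply: (garrow_comp (garrow_inv et)).
exact: garrow_comp (garrowE x) (transversalP e).
Qed.

Definition retraction (x : G) : V :=
  if pselect (connected_to_base (cdom x)) is left e
  then Vertex (retraction_subproof e) else 1%g.

(** The transversal factors at the middle object cancel. Sending the other components to 1 is
    consistent because composable arrows lie in one component. *)
Lemma retraction_functor : is_functor_to_group retraction.
Proof.
move=> c d cd.
have hc := garrowE c; have hd := garrowE d; rewrite -cd in hd.
have hcd := garrow_comp hc hd.
rewrite /retraction.
case: pselect => [e|ne]; last first.
  move: ne; rewrite (proj1 hcd) => ne.
  case: pselect => [e1|n1]; first by case: ne; apply/(connected_to_base_iff hd).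
  by case: pselect => // _; rewrite mulg1.
have ed : connected_to_base (cdom d) by rewrite -(proj1 hcd).
have ec : connected_to_base (cdom c).
  exact: (iffLR (connected_to_base_iff hd)).
case: pselect => // e1; case: pselect => // e2; apply: val_inj => /=.
rewrite (proj1 hcd) (proj2 hcd) -cd.
have ec' : connected_to_base (ctgt c).
  exact: (iffLR (connected_to_base_iff hc)).
have [t0 t1 t2] := And3 (transversalP ed) (transversalP ec) (transversalP ec').
have dt0 := garrow_comp hd t0.
have t1dt0 := garrow_comp (garrow_inv t1) dt0.
rewrite -(garrow_compA (garrow_inv t2) (garrow_comp hc t1) t1dt0).
rewrite -(garrow_compA hc t1 t1dt0).
by rewrite (garrow_KV t1 dt0) (garrow_compA hc hd t0).
Qed.

(** The chosen arrow [t] at the base itself need not be an identity, so a loop is sent to its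
    conjugate by [t]; conjugation still detects triviality. *)
Lemma retraction_eq1 : ctgt g = u -> retraction g = 1%g -> g = u.
Proof.
move=> gu; rewrite /retraction; case: pselect => [e|[]]; last first.
  by exists u; exact: (proj1 (garrow_id (garrowE g))).
move=> /(congr1 val) /=; rewrite gu => h.
have := transversalP e; move: h; set t := transversal _ => h ht.
have gt : garrow u u (ccomp g t).
  by apply: garrow_comp ht.
have := garrow_KV ht gt; rewrite h (garrow_1mul ht) => tgt.
have hg : garrow u u g by [].
have := garrow_compA hg ht (garrow_inv ht).
by rewrite -tgt (garrow_mulV ht) (garrow_1mul hg).
Qed.

End VertexGroup.

Section UniversalGroup.
Variables (G : groupoid) (U : groupType) (j : G -> U).
Hypothesis jU : is_universal_group j.

(** Two test functors suffice. If the ends of [g] differ, the coboundary of the indicator of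
    [cdom g], with values in [{perm bool}] as a group of order two, sends [g] to the transposition.
    If [g] is a loop, [retraction] at its base detects it. *)
Lemma universal_group_eq1 (g : G) : j g = 1%g -> g = cdom g.
Proof.
case: jU => jF jP jg1.
have mu1 (H : groupType) (mu : G -> H) : is_functor_to_group mu -> mu g = 1%g.
  move=> /jP[mu' [[mu'M mu'E] _]]; rewrite mu'E jg1.
  by apply: (mulgI (mu' 1%g)); rewrite -mu'M !mulg1.
have gu : ctgt g = cdom g.
  apply: contrapT => gu.
  pose s v : {perm bool} := if `[< v = cdom g >] then tperm true false else 1%g.
  have ss v : (s v * s v)%g = 1%g.
    by rewrite /s; case: ifP; rewrite ?mulg1 ?tperm2.
  have /mu1 : is_functor_to_group (fun x : G => s (ctgt x) * s (cdom x))%g.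
    move=> c d cd; rewrite cdom_comp // ctgt_comp //.
    by rewrite -!mulgA (mulgA (s (cdom c))) cd ss mul1g.
  rewrite /s asboolF // asboolT // mul1g => /permP/(_ true).
  by rewrite tpermL perm1.
exact: retraction_eq1 gu (mu1 _ _ (@retraction_functor G g)).
Qed.

Lemma functor_to_group_inv (g : G) : j (ginv g) = (j g)^-1%g.
Proof.
case: jU => jF _; have j1 v (a : G) : garrow v v v -> j v = 1%g.
  move=> [h1 h2]; apply: (mulgI (j v)); rewrite -jF ?mulg1 ?h1 ?h2 //.
  by rewrite -{2}h1 ccomp_dom.
apply: (mulIg (j g)); rewrite -jF ?gdom_inv // gmulVg mulVg.
exact/j1/(proj1 (garrow_id (garrowE g))).
Qed.

(** The common source makes [ccomp g (ginv h)] composable; its image is 1, so it is an identity. *)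
Lemma universal_group_inj (g h : G) : cdom g = cdom h -> j g = j h -> g = h.
Proof.
move=> gh jgh; case: (jU) => jF _.
have hh := garrowE h; have hg := garrowE g; rewrite gh in hg.
have hgh := garrow_comp hg (garrow_inv hh).
have /universal_group_eq1 : j (ccomp g (ginv h)) = 1%g.
  by rewrite jF ?gtgt_inv // functor_to_group_inv jgh mulgV.
rewrite (proj1 hgh) => e.
have := garrow_compA hg (garrow_inv hh) hh.
by rewrite e (garrow_Vmul hh) (garrow_mul1 hh) (garrow_1mul hg).
Qed.

End UniversalGroup.

(** * Characters and the action of I_l *)

(** The only trace of the embedding used for I_l, its characters and the topology of Omega: it makes
    the generators [lmul c] injective. *)
Definition left_cancellative (C : category) := forall c x y : C,
  ctgt x = cdom c -> ctgt y = cdom c -> ccomp c x = ccomp c y -> x = y.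

Lemma inv_relationK (T : Type) (s : set (T * T)) : ((s^-1)^-1)%relation = s.
Proof. by apply/funext => -[]. Qed.

Lemma set_val_surj (T : Type) (A : set T) x :
  A x -> exists y : A, set_val y = x.
Proof. by move=> Ax; exists (exist _ x (mem_set Ax)). Qed.

Section Characters.
Variable C : category.
Hypothesis C_cancel : left_cancellative C.
Implicit Types (s t : set (C * C)) (X Y : set C) (chi : cube C).

Lemma Il_partial_bijection s : Il s ->
  (forall x y z, s (x, y) -> s (x, z) -> y = z) /\
  (forall x y z, s (x, z) -> s (y, z) -> x = y).
Proof.
elim=> [c|{}s _ [sf si]|{}s t _ [sf si] _ [tf ti]].
- split=> x y z; first by move=> [/= _ ->] [/= _ ->].
  by move=> [/= hx zx] [/= hy zy]; apply: (C_cancel hx hy); rewrite -zx.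
- by split=> x y z /= h1 h2; [exact: si h1 h2|exact: sf h1 h2].
- split=> x y z [/= u h1 h2] [/= v k1 k2].
    by rewrite (tf _ _ _ h1 k1) in h2; exact: sf h2 k2.
  by rewrite (si _ _ _ h2 k2) in h1; exact: ti h1 k1.
Qed.

Lemma Il_fun s x y z : Il s -> s (x, y) -> s (x, z) -> y = z.
Proof. by move=> /Il_partial_bijection[h _]; exact: h. Qed.

Lemma Il_inj s x y z : Il s -> s (x, z) -> s (y, z) -> x = y.
Proof. by move=> /Il_partial_bijection[_]; exact. Qed.

Lemma Jset_pdom s : Il s -> Jset (pdom s).
Proof. by move=> ss; exists s. Qed.

Lemma Jset_ppreim s X : Il s -> Jset X -> Jset (ppreim s X).
Proof.
move=> ss [t tt ->]; exists (t \; s)%relation; first exact: Il_mul.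
apply/seteqP; split=> [x [y [z yz] xy]|x [z [y /= xy yz]]].
  by exists z, y.
by exists y => //; exists z.
Qed.

(** Intersecting with dom(s) is taking the preimage under the idempotent s^-1 s. *)
Lemma Jset_setI X Y : Jset X -> Jset Y -> Jset (X `&` Y).
Proof.
move=> [s ss ->] JY.
have -> : pdom s `&` Y = ppreim (s^-1 \; s)%relation Y.
  apply/seteqP; split=> [x [[z xz] Yx]|x [y Yy [z /= xz yz]]].
    by exists x => //; exists z.
  by split; [exists z|rewrite (Il_inj ss xz yz)].
by apply: Jset_ppreim JY; apply: Il_mul => //; exact: Il_inv.
Qed.

Lemma ppreim_comp s t X : ppreim (s \; t)%relation X = ppreim t (ppreim s X).
Proof.
apply/seteqP; split=> [x [y Xy [z /= xz zy]]|x [z [y Xy zy] xz]].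
  by exists z => //; exists y.
by exists y => //; exists z.
Qed.

Lemma ppreim_pdom s t : ppreim t (pdom s) = pdom (s \; t)%relation.
Proof.
apply/seteqP; split=> [x [y [z yz] xy]|x [z [y /= xy yz]]].
  by exists z, y.
by exists y => //; exists z.
Qed.

Lemma ppreim_setI s X Y : Il s ->
  ppreim s (X `&` Y) = ppreim s X `&` ppreim s Y.
Proof.
move=> ss; apply/seteqP; split=> [x [y [Xy Yy] xy]|x [[y Xy xy] [z Yz xz]]].
  by split; exists y.
by exists y => //; split=> //; rewrite (Il_fun ss xy xz).
Qed.

Lemma ppreim_id s X : Il s -> ppreim (s^-1 \; s)%relation X = pdom s `&` X.
Proof.
move=> ss; apply/seteqP; split=> [x [y Xy [z /= xz yz]]|x [[z xz] Xx]].
  by split; [exists z|rewrite (Il_inj ss xz yz)].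
by exists x => //; exists z.
Qed.

Lemma suppE chi (X : @Jset C) : supp chi (set_val X) <-> chi X.
Proof. by split=> [[Y /val_inj ->]|h]; last exists X. Qed.

Lemma supp_Jset chi X : supp chi X -> Jset X.
Proof. by move=> [Y <- _]; exact: set_mem (valP Y). Qed.

Lemma supp_inj chi chi' : supp chi = supp chi' -> chi = chi'.
Proof.
move=> e; apply/funext => X; apply/idP/idP => /suppE h; apply/suppE.
  by rewrite -e.
by rewrite e.
Qed.

Section OneCharacter.
Variable chi : cube C.
Hypothesis chiP : is_character chi.

(** Together with the next two lemmas: the support of a character is a proper filter in J, which is
    the form in which characters are used below. *)
Lemma supp_setI X Y : supp chi X -> supp chi Y -> supp chi (X `&` Y).
Proof.
move=> [X' <- hX] [Y' <- hY]; case: chiP => _ h _; apply/h.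
by rewrite hX hY.
Qed.

Lemma supp_up X Y : supp chi X -> Jset Y -> X `<=` Y -> supp chi Y.
Proof.
move=> [X' <- hX] JY; have [Y' <-] := set_val_surj JY => /setIidPl XY.
case: chiP => _ h _.
by have /h/andP[_] : supp chi (set_val X' `&` set_val Y')
  by [rewrite XY; exists X']; exists Y'.
Qed.

Lemma supp_nonempty X : supp chi X -> X !=set0.
Proof.
move=> hX; apply/set0P/eqP => X0; case: chiP => _ _; apply.
by rewrite X0 in hX.
Qed.

End OneCharacter.

Lemma supp_act s chi X : Il s -> Jset X ->
  supp (act s chi) X <-> supp chi (ppreim s X).
Proof.
move=> ss JX; have [Y <-] := set_val_surj JX.
by rewrite suppE; split=> /asboolP.
Qed.

Lemma act_character s chi : Il s -> is_character chi -> supp chi (pdom s) ->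
  is_character (act s chi).
Proof.
move=> ss chiP sd; have Jim := Jset_pdom (Il_inv ss).
have JP (X : @Jset C) : Jset (set_val X) := set_mem (valP X).
split.
- have [X XE] := set_val_surj Jim; exists X; apply/suppE.
  rewrite XE; apply/supp_act => //; congr (supp chi _): sd.
  apply/seteqP; split=> [x [y xy]|x [y _ xy]]; last by exists y.
  by exists y => //; exists x.
- move=> X Y; rewrite supp_act //; last exact: Jset_setI.
  rewrite ppreim_setI //; split=> [h|/andP[/asboolP hX /asboolP hY]].
    apply/andP; split; apply/asboolP; apply: (supp_up chiP h).
    - exact: (Jset_ppreim ss (JP X)).
    - by move=> x [].
    - exact: (Jset_ppreim ss (JP Y)).
    - by move=> x [].
  exact: supp_setI.
- move=> h; have J0 := supp_Jset h; move/supp_act: h => /(_ ss J0).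
  by move=> /(supp_nonempty chiP)[x [y]].
Qed.

Lemma act_comp s t chi : Il s -> Il t ->
  act (s \; t)%relation chi = act s (act t chi).
Proof.
move=> ss tt; apply/funext => X; rewrite /act; apply: asbool_equiv_eq.
rewrite supp_act ?ppreim_comp //; apply: Jset_ppreim => //.
exact: set_mem (valP X).
Qed.

(** The preimages of a set under [s] and [t] have the same trace on [X], and a filter containing [X]
    sees only that trace. *)
Lemma act_agree s t chi X : Il s -> Il t -> is_character chi -> supp chi X ->
  (forall x, X x -> exists y, s (x, y) /\ t (x, y)) -> act s chi = act t chi.
Proof.
move=> ss tt chiP hX st; apply/funext => Y; apply: asbool_equiv_eq.
have JY : Jset (set_val Y) := set_mem (valP Y).
suff H u v : Il u -> Il v ->
    (forall x, X x -> exists y, u (x, y) /\ v (x, y)) ->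
    supp chi (ppreim u (set_val Y)) -> supp chi (ppreim v (set_val Y)).
  split; apply: H => // x /st[y [h1 h2]]; by exists y.
move=> uu vv uv /(supp_setI chiP hX) h; apply: (supp_up chiP h).
  exact: Jset_ppreim.
move=> x [/uv[y [uxy vxy]] [z Yz uxz]]; exists y => //.
by rewrite (Il_fun uu uxy uxz).
Qed.

Lemma act_idem s chi : Il s -> is_character chi -> supp chi (pdom s) ->
  act (s^-1 \; s)%relation chi = chi.
Proof.
move=> ss chiP sd; apply/funext => X; apply/idP/idP.
  move=> /asboolP; rewrite ppreim_id // => h; apply/suppE.
  by apply: (supp_up chiP h) => [|x []//]; exact: set_mem (valP X).
move=> /suppE h; apply/asboolP; rewrite ppreim_id //; exact: supp_setI.
Qed.

Lemma act_inv s chi : Il s -> is_character chi -> supp chi (pdom s) ->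
  act (s^-1)%relation (act s chi) = chi.
Proof. by move=> ss *; rewrite -act_comp ?act_idem //; exact: Il_inv. Qed.

Lemma supp_act_pim s chi : Il s -> supp chi (pdom s) ->
  supp (act s chi) (pdom (s^-1)%relation).
Proof.
move=> ss sd; apply/supp_act => //; first exact/Jset_pdom/Il_inv.
congr (supp chi _): sd.
apply/seteqP; split=> [x [y xy]|x [y _ xy]]; last by exists y.
by exists y => //; exists x.
Qed.

Lemma act_Omega s chi : Il s -> Omega_set chi -> supp chi (pdom s) ->
  Omega_set (act s chi).
Proof.
move=> ss [chiP chic] sd; split; first exact: act_character.
move=> X n F X0 F0 XF /asboolP hX.
have JP (Y : @Jset C) : Jset (set_val Y) := set_mem (valP Y).
have [x [y Xy xy]] := supp_nonempty chiP hX.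
have [i0 _ Fi0] : (\bigcup_i set_val (F i)) y by rewrite -XF.
(* The cover condition speaks only of nonempty members, whereas some preimages may be empty. These
   are replaced by the preimage of [F i0], which contains [x]. *)
have [G GE] : exists G : 'I_n -> @Jset C, forall i, set_val (G i) =
    if `[< ppreim s (set_val (F i)) !=set0 >] then ppreim s (set_val (F i))
    else ppreim s (set_val (F i0)).
  have JG i : exists Y : @Jset C, set_val Y =
      if `[< ppreim s (set_val (F i)) !=set0 >] then ppreim s (set_val (F i))
      else ppreim s (set_val (F i0)).
    by case: ifP => _; apply: set_val_surj; exact: Jset_ppreim.
  by exists (fun i => projT1 (cid (JG i))) => i; case: cid.
have [X' X'E] := set_val_surj (Jset_ppreim ss (JP X)).
have [||||i] := chic X' n G.
- by rewrite X'E; exists x, y.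
- move=> i; rewrite GE; case: ifP => [/asboolP//|_].
  by exists x, y.
- rewrite X'E XF; apply/seteqP; split.
    move=> z [w [i _ Fw] zw]; exists i => //.
    rewrite GE asboolT; first by exists w.
    by exists z, w.
  move=> z [i _]; rewrite GE; case: ifP => _ [w Fw zw]; exists w => //.
    by exists i.
  by exists i0.
- by apply/suppE; rewrite X'E.
- move=> /suppE; rewrite GE; case: ifP => _ h; [exists i|exists i0].
    exact/asboolP.
  exact/asboolP.
Qed.

(** A character above s.chi is defined on im(s), so it can be moved back by s^-1; there it lies
    above [chi], hence equals it. *)
Lemma act_maximal s chi : Il s -> is_maximal chi -> supp chi (pdom s) ->
  is_maximal (act s chi).
Proof.
move=> ss [chiP chim] sd; have sV := Il_inv ss.
split; first exact: act_character.
move=> gamma gammaP sub.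
have gd : supp gamma (pdom (s^-1)%relation) by apply: sub; exact: supp_act_pim.
have gV := act_character sV gammaP gd.
suff : act (s^-1)%relation gamma = chi.
  by move=> <-; have := act_inv sV gammaP gd; rewrite inv_relationK => ->.
apply: supp_inj; apply: chim => //.
rewrite -[X in supp X](act_inv ss chiP sd) => X.
have [JX|nJ h] := pselect (Jset X); last by case: nJ; exact: supp_Jset h.
rewrite !supp_act //; last exact: Jset_ppreim.
by move=> h; apply: sub; apply/supp_act => //; exact: Jset_ppreim.
Qed.

End Characters.

(** * Corners of operators on l^2 spaces *)

Section L2Norm.
Variables (R : realType) (I : choiceType).
Implicit Types (xi eta : L2 R I) (x : I -> R[i]^o).

Lemma normc_ge0 (z : R[i]) : 0 <= Normc.normc z.
Proof. by case: z => a b; exact: sqrtr_ge0. Qed.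

Lemma sqnorm_ge0 x : (0 <= sqnorm x)%E.
Proof. by apply: esum_ge0 => i _; rewrite lee_fin sqr_ge0. Qed.

Lemma L2_lty xi : (sqnorm xi < +oo)%E.
Proof. by have /asboolP := L2P xi. Qed.

Lemma L2_fin_num xi : sqnorm xi \is a fin_num.
Proof. by rewrite ge0_fin_numE ?sqnorm_ge0 // L2_lty. Qed.

Lemma L2_eqP xi eta : (forall i, xi i = eta i) -> xi = eta.
Proof. by move=> e; apply: val_inj; apply/funext. Qed.

Lemma L2_addE xi eta i : (xi + eta) i = xi i + eta i.
Proof. by []. Qed.

Lemma L2_oppE xi i : (- xi) i = - xi i.
Proof. by []. Qed.

Lemma L2_scaleE (a : R[i]) xi i : (a *: xi) i = a * xi i.
Proof. by []. Qed.

Lemma L2_zeroE i : (0 : L2 R I) i = 0.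
Proof. by []. Qed.

Lemma toL2E x i : (sqnorm x < +oo)%E -> toL2 x i = x i.
Proof. by move=> h; rewrite /toL2 insubdK //; exact/asboolP. Qed.

Lemma l2norm_ge0 xi : 0 <= l2norm xi.
Proof. exact: sqrtr_ge0. Qed.

Lemma sqr_l2norm xi : ((l2norm xi) ^+ 2)%:E = sqnorm xi.
Proof.
by rewrite /l2norm sqr_sqrtr ?fineK ?L2_fin_num // fine_ge0 // sqnorm_ge0.
Qed.

(* The factor 2 makes [sqnormD] sufficient, without Minkowski's inequality; it
   is harmless for closures. *)
Lemma l2normD_le xi eta : l2norm (xi + eta) <= 2 * (l2norm xi + l2norm eta).
Proof.
have := sqnormD xi eta.
rewrite -[(L2_val xi + L2_val eta)%R]/(L2_val (xi + eta)).
rewrite -!sqr_l2norm -!EFinD lee_fin.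
move: (l2norm_ge0 xi) (l2norm_ge0 eta) (l2norm_ge0 (xi + eta)).
move: (l2norm xi) (l2norm eta) (l2norm (xi + eta)) => a b c a0 b0 c0 h.
have ab : 0 <= 2 * (a + b) by lra.
rewrite -(@ler_pXn2r _ 2) ?nnegrE //; apply: (le_trans h).
have := mulr_ge0 a0 b0; have := sqr_ge0 a; have := sqr_ge0 b.
by rewrite exprMn sqrrD; lra.
Qed.

Lemma l2norm_eq0 xi : l2norm xi = 0 -> xi = 0.
Proof.
move=> h; apply: L2_eqP => i; apply: Normc.eq0_normc.
have : (((Normc.normc (xi i)) ^+ 2)%:E <= sqnorm xi)%E.
  pose f i : \bar R := ((Normc.normc (xi i)) ^+ 2)%:E.
  rewrite -[leLHS]/(f i) -(esum_set1 (a := f)); last first.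
    by rewrite lee_fin sqr_ge0.
  rewrite esum_mkcond; apply: le_esum => k _.
  by case: ifP => // _; rewrite lee_fin sqr_ge0.
rewrite -sqr_l2norm h lee_fin expr0n /= => le0.
by apply/eqP; rewrite -[_ == 0]sqrf_eq0 eq_le le0 sqr_ge0.
Qed.

Lemma l2norm0 : l2norm (0 : L2 R I) = 0.
Proof.
rewrite /l2norm /sqnorm esum1 ?sqrtr0 // => i _.
by rewrite L2_zeroE Normc.normc0 expr0n.
Qed.

Lemma l2normN xi : l2norm (- xi) = l2norm xi.
Proof.
rewrite /l2norm; congr (Num.sqrt (fine _)); apply: eq_esum => i _.
by rewrite L2_oppE normcN.
Qed.

End L2Norm.

Lemma l2norm_le (R : realType) (I J : choiceType) (c : R) (xi : L2 R I)
    (eta : L2 R J) : 0 <= c ->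
  (sqnorm xi <= (c ^+ 2)%:E * sqnorm eta)%E -> l2norm xi <= c * l2norm eta.
Proof.
move=> c0; rewrite -!sqr_l2norm -EFinM lee_fin -exprMn.
by rewrite ler_pXn2r // nnegrE ?mulr_ge0 ?l2norm_ge0.
Qed.

Section ZeroExtension.
Variables (R : realType) (I K : choiceType) (iota : I -> K).
Hypothesis iota_inj : injective iota.
Implicit Types (x : I -> R[i]^o) (y : K -> R[i]^o).

Definition extend0 x : K -> R[i]^o := fun k =>
  if pselect (exists i, iota i = k) is left e then x (projT1 (cid e)) else 0.

Lemma extend0E x i : extend0 x (iota i) = x i.
Proof.
rewrite /extend0; case: pselect => [e|[]]; last by exists i.
by case: cid => k /= /iota_inj ->.
Qed.

Lemma extend0_out x k : (forall i, iota i <> k) -> extend0 x k = 0.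
Proof.
rewrite /extend0; case: pselect => // e ne.
by case: e (e) => i ik; case: (ne i).
Qed.

Lemma sqnorm_comp y :
  sqnorm (y \o iota) =
  (\esum_(k in range iota) ((Normc.normc (y k)) ^+ 2)%:E)%E.
Proof.
rewrite (@esum_image _ _ _ setT iota
  (fun k => ((Normc.normc (y k)) ^+ 2)%:E)) //.
by move=> a b _ _; exact: iota_inj.
Qed.

Lemma sqnorm_comp_le y : (sqnorm (y \o iota) <= sqnorm y)%E.
Proof.
rewrite sqnorm_comp esum_mkcond; apply: le_esum => k _.
by case: ifP => // _; rewrite lee_fin sqr_ge0.
Qed.

Lemma sqnorm_extend0 x : sqnorm (extend0 x) = sqnorm x.
Proof.
transitivity (sqnorm (extend0 x \o iota)); last first.
  by congr sqnorm; apply/funext => i /=; rewrite extend0E.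
rewrite sqnorm_comp esum_mkcond; apply: eq_esum => k _.
case: ifPn => [//|].
move=> /negP h; rewrite extend0_out ?Normc.normc0 ?expr0n // => i ik.
by apply: h; apply/mem_set; exists i.
Qed.

Lemma extL2_subproof (xi : L2 R I) : extend0 xi \in @l2 R K.
Proof. by apply/asboolP; rewrite sqnorm_extend0 L2_lty. Qed.

Lemma resL2_subproof (eta : L2 R K) : (eta \o iota) \in @l2 R I.
Proof.
by apply/asboolP; exact: le_lt_trans (sqnorm_comp_le _) (L2_lty eta).
Qed.

Definition extL2 (xi : L2 R I) : L2 R K := MkL2 (extL2_subproof xi).
Definition resL2 (eta : L2 R K) : L2 R I := MkL2 (resL2_subproof eta).

Lemma extL2K : cancel extL2 resL2.
Proof. by move=> xi; apply: L2_eqP => i; rewrite /= extend0E. Qed.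

Lemma extL2_linear : linear extL2.
Proof.
move=> a xi eta; apply: L2_eqP => k.
rewrite L2_addE L2_scaleE /= /extend0.
by case: pselect => [e|ne]; rewrite ?L2_addE ?L2_scaleE // mulr0 addr0.
Qed.

Lemma resL2_linear : linear resL2.
Proof. by move=> a xi eta; apply: L2_eqP. Qed.

HB.instance Definition _ := GRing.isLinear.Build _ _ _ _ extL2 extL2_linear.
HB.instance Definition _ := GRing.isLinear.Build _ _ _ _ resL2 resL2_linear.

Lemma l2norm_extL2 xi : l2norm (extL2 xi) = l2norm xi.
Proof. by rewrite /l2norm sqnorm_extend0. Qed.

Lemma l2norm_resL2 eta : l2norm (resL2 eta) <= l2norm eta.
Proof.
rewrite -[leRHS]mul1r; apply: l2norm_le => //.
by rewrite expr1n mul1e; exact: sqnorm_comp_le.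
Qed.

(* Both partial sums define the same filter: intersecting a finite subset of K
   with the range of iota gives a finite subset of I. *)
Lemma partial_sum_extend (u : I -> R[i]^o) (v : K -> R[i]^o) :
  (forall i, v (iota i) = u i) ->
  (forall k, (forall i, iota i <> k) -> v k = 0) ->
  partial_sum v @ totally = partial_sum u @ totally.
Proof.
move=> vu v0.
have psE (T : choiceType) (w : T -> R[i]^o) (A : {fset T}) :
    partial_sum w A = \sum_(i \in [set` A]) w i.
  by rewrite /partial_sum -fsbig_seq ?fset_uniq // big_seq_fsetE.
have ps (A : {fset K}) (B : {fset I}) :
    (forall i, (i \in B) = (iota i \in A)) ->
    partial_sum v A = partial_sum u B.
  move=> AB; rewrite !psE.
  rewrite -(@fsbig_widen _ _ _ _ (iota @` [set` B])); last 2 first.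
  - by move=> _ [i /= + <-]; rewrite AB.
  - move=> k [/= kA nk]; apply: v0 => i ik; apply: nk.
    by exists i => //=; rewrite AB ik.
  rewrite (@reindex_fsbig _ _ _ _ _ iota [set` B]); last first.
    by apply: inj_bij => a b _ _; exact: iota_inj.
  by apply: eq_fsbigr => i _.
have pre (A : {fset K}) :
    exists B : {fset I}, forall i, (i \in B) = (iota i \in A).
  have fA : finite_set (iota @^-1` [set` A]).
    by apply: finite_preimage => // a b _ _; exact: iota_inj.
  exists (fset_set (iota @^-1` [set` A])) => i.
  by rewrite in_fset_set //; apply/idP/idP => [/set_mem //|h]; exact/mem_set.
apply/funext => P; apply/propext; split.
  move=> [A _ AP]; have [B BA] := pre A; exists B => // B' BB'.
  have /= := AP (A `|` [fset iota i | i in B'])%fset (fsubsetUl _ _).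
  rewrite (ps _ B') // => i; rewrite in_fsetU -BA.
  apply/idP/orP => [h|[|/imfsetP[k /= kB' /iota_inj ->//]]].
    by right; apply/imfsetP; exists i.
  by move=> iB; exact: (fsubsetP BB').
move=> [B _ BP]; exists [fset iota i | i in B]%fset => // A BA.
have [B' B'A] := pre A.
rewrite /preimage /= (ps _ B') //; apply: BP; apply/fsubsetP => i iB.
by rewrite B'A; apply: (fsubsetP BA); apply/imfsetP; exists i.
Qed.

(** The two sums have the same limit because the filters of their partial sums coincide. So [extL2]
    and [resL2] are adjoint to each other, which makes [corner] respect adjoints. *)
Lemma inner_extL2l xi eta : inner (extL2 xi) eta = inner xi (resL2 eta).
Proof.
rewrite /inner; congr lim; apply: partial_sum_extend => [i|k nk] /=.
  by rewrite extend0E.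
by rewrite extend0_out // mul0r.
Qed.

Lemma inner_extL2r eta xi : inner eta (extL2 xi) = inner (resL2 eta) xi.
Proof.
rewrite /inner; congr lim; apply: partial_sum_extend => [i|k nk] /=.
  by rewrite extend0E.
by rewrite extend0_out // rmorph0 mulr0.
Qed.

(** This is S -> V S V^* for the isometry V = [extL2]: the operator acts on the block indexed by the
    range of [iota] and is 0 on its complement. It is multiplicative since V^* V = 1. *)
Definition corner (S : L2 R I -> L2 R I) : L2 R K -> L2 R K :=
  fun eta => extL2 (S (resL2 eta)).

Lemma corner_inj : injective corner.
Proof.
move=> S T ST; apply/funext => xi.
have := congr1 (fun f => resL2 (f (extL2 xi))) ST.
by rewrite /corner !extL2K.
Qed.

(** Extension by zero preserves [sqnorm], so both sides fall back on the default value 0 for the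
    same [x]. *)
Lemma toL2_extend0 x : toL2 (extend0 x) = extL2 (toL2 x).
Proof.
apply: L2_eqP => k /=; case: (pselect (sqnorm x < +oo)%E) => h.
  rewrite toL2E ?sqnorm_extend0 //; rewrite /extend0.
  by case: pselect => // e; rewrite toL2E.
have -> : toL2 x = 0 :> L2 R I.
  by rewrite /toL2 /insubd insubN //; apply/asboolPn.
have -> : toL2 (extend0 x) = 0 :> L2 R K.
  by rewrite /toL2 /insubd insubN //; apply/asboolPn; rewrite sqnorm_extend0.
by rewrite /extend0; case: pselect.
Qed.

Lemma corner_bounded S : bounded_operator S -> bounded_operator (corner S).
Proof.
move=> [Slin [M SM]]; split=> [a xi eta|].
  by rewrite /corner linearP Slin linearP.
exists (Num.max M 0) => xi; rewrite l2norm_extL2; apply: le_trans (SM _) _.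
apply: (@le_trans _ _ (Num.max M 0 * l2norm (resL2 xi))).
  by apply: ler_wpM2r; rewrite ?l2norm_ge0 // le_max lexx.
by apply: ler_wpM2l; rewrite ?le_max ?lexx ?orbT // l2norm_resL2.
Qed.

Variables (A : set (L2 R I -> L2 R I)) (B : set (L2 R K -> L2 R K)).
Hypothesis AB : forall S, A S -> op_closure B (corner S).
Hypothesis BA : forall T, B T -> op_closure [set corner S | S in A] T.

Lemma corner_closure S : op_closure A S -> op_closure B (corner S).
Proof.
move=> [Sb SA]; split; first exact: corner_bounded.
(* Two errors of [e / 4] give [e], because of the factor 2 in [l2normD_le]. *)
move=> e e0; have e4 : 0 < e / 4 by rewrite divr_gt0.
have [S1 /AB[_ S1B] h1] := SA _ e4.
have [T TB hT] := S1B _ e4; exists T => // xi.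
rewrite -(subrKA (corner S1 xi)); apply: le_trans (l2normD_le _ _) _.
have h2 := hT xi.
have : l2norm (corner S xi - corner S1 xi) <= e / 4 * l2norm xi.
  rewrite /corner -linearB l2norm_extL2; apply: le_trans (h1 _) _.
  by rewrite ler_wpM2l ?l2norm_resL2 // ltW.
by move: h2; move: (l2norm xi) (l2norm_ge0 xi) => n n0; lra.
Qed.

(** The preimage is the compression V^* T V. Since [T] is approximated by corners, and compressing a
    corner returns the original operator, [T] and the corner of the compression are arbitrarily
    close to the same corners, hence equal. *)
Lemma closure_corner T : op_closure B T ->
  exists2 S, op_closure A S & corner S = T.
Proof.
move=> [[Tlin [M TM]] TB].
pose S xi := resL2 (T (extL2 xi)).
have near (e : R) : 0 < e ->
    exists2 S1, A S1 & opnorm_le (fun xi => T xi - corner S1 xi) e.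
  move=> e0; have e4 : 0 < e / 4 by rewrite divr_gt0.
  have [T1 /BA[_ T1A] h1] := TB _ e4; have [_ [S1 AS1 <-] hS] := T1A _ e4.
  exists S1 => // xi; rewrite -(subrKA (T1 xi)).
  apply: le_trans (l2normD_le _ _) _.
  move: (h1 xi) (hS xi).
  by move: (l2norm xi) (l2norm_ge0 xi) => n n0; lra.
have SS1 (e : R) S1 : opnorm_le (fun xi => T xi - corner S1 xi) e ->
    opnorm_le (fun xi => S xi - S1 xi) e.
  move=> h xi; rewrite -[l2norm xi]l2norm_extL2; apply: le_trans (h _).
  rewrite /corner extL2K /S -[X in _ - X]extL2K -linearB; exact: l2norm_resL2.
exists S.
  split; last by move=> e /near[S1 AS1 h1]; exists S1 => //; exact: SS1.
  split=> [a xi eta|]; first by rewrite /S linearP Tlin linearP.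
  exists M => xi; apply: le_trans (l2norm_resL2 _) _.
  by rewrite -[l2norm xi]l2norm_extL2; exact: TM.
apply/funext => xi; apply/eqP; rewrite -subr_eq0; apply/eqP/l2norm_eq0.
apply/eqP; rewrite eq_le l2norm_ge0 andbT; apply/ler_addgt0Pr => e e0.
rewrite add0r.
have n0 := l2norm_ge0 xi; set n := l2norm xi in n0 *.
(* The accuracy is adapted to the norm [n] of the vector tested; adding 1 covers [n = 0]. *)
have d0 : 0 < e / (4 * (n + 1)) by rewrite divr_gt0 // mulr_gt0 // ltr_wpDl.
have [S1 _ h1] := near _ d0.
rewrite -(subrKA (corner S1 xi)); apply: le_trans (l2normD_le _ _) _.
have ha : l2norm (corner S xi - corner S1 xi) <= e / (4 * (n + 1)) * n.
  rewrite /corner -linearB l2norm_extL2; apply: le_trans (SS1 _ _ h1 _) _.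
  by rewrite ler_wpM2l ?l2norm_resL2 // ltW.
have hb : l2norm (corner S1 xi - T xi) <= e / (4 * (n + 1)) * n.
  by rewrite -opprB l2normN; exact: h1.
have hc : e / (4 * (n + 1)) * n <= e / 4.
  have n1 : n + 1 != 0 by rewrite gt_eqF // ltr_wpDl.
  rewrite -[leRHS](divfK n1) invfM mulrA ler_wpM2l ?lerDl //.
  by rewrite !divr_ge0 ?addr_ge0 // ltW.
lra.
Qed.

Lemma corner_star_iso : is_star_iso (op_closure A) (op_closure B) corner.
Proof.
split.
- split=> [S /corner_closure//|S T _ _ /corner_inj//|T /closure_corner[S]].
  by exists S.
- by move=> a S T _ _; apply/funext => xi; rewrite /corner linearP.
- by move=> S T _ _; apply/funext => xi; rewrite /corner /= extL2K.
- move=> S S' _ _ SS' xi eta.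
  by rewrite /corner inner_extL2l SS' inner_extL2r.
Qed.

End ZeroExtension.

(** * Subspace topologies, and a continuous cutoff on the complex numbers *)

Lemma nbhs_set_val (T : topologicalType) (Y : set T) (y : Y) (A : set Y) :
  nbhs y A <->
  exists V, [/\ open V, V (set_val y) & forall z : Y, V (set_val z) -> A z].
Proof.
rewrite nbhsE; split=> [[_ [[V oV <-] Vy] VA]|[V [oV Vy VA]]].
  by exists V.
by exists (set_val @^-1` V) => //; split=> //; exists V.
Qed.

Lemma open_set_val (T : topologicalType) (Y : set T) (V : set T) : open V ->
  open (set_val @^-1` V : set Y).
Proof. by move=> oV; exists V. Qed.

Lemma open_set_valP (T : topologicalType) (Y : set T) (A : set Y) : open A ->
  exists2 V, open V & A = set_val @^-1` V.
Proof. by move=> [V oV <-]; exists V. Qed.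

Lemma set_type_hausdorff (T : topologicalType) (Y : set T) :
  hausdorff_space T -> hausdorff_space (set_type Y).
Proof.
move=> hT x y xy; apply: val_inj; apply: hT => A B.
rewrite !nbhsE => -[A' [oA' A'x] A'A] [B' [oB' B'y] B'B].
have [||z [zA zB]] := xy (set_val @^-1` A') (set_val @^-1` B').
- by apply/nbhs_set_val; exists A'.
- by apply/nbhs_set_val; exists B'.
by exists (set_val z); split; [exact: A'A|exact: B'B].
Qed.

Section NormC.
Variable R : realType.

Lemma normc_distC (z w : R[i]) : Normc.normc (z - w) = Normc.normc (w - z).
Proof. by rewrite -(opprB w z) [LHS]normcN. Qed.

(** The norm of [R[i]] is itself complex-valued; this returns to the real modulus. *)
Lemma normc_dist_lt (z w : R[i]^o) (e : R) : `|z - w| < e%:C%C ->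
  Normc.normc (z - w) < e.
Proof. by move=> /= h; rewrite -ltcR. Qed.

Lemma normc_continuous : continuous (@Normc.normc R : R[i]^o -> R^o).
Proof.
move=> z; apply/(@cvgrPdist_lt _ (R^o) _ (nbhs z) (nbhs_filter z)) => e e0.
have zw : \forall w \near z, `|z - w| < e%:C%C.
  apply: (iffLR (@cvgrPdist_lt _ (R[i]^o) _ _ (nbhs_filter z) id z)) => //.
  by rewrite ltcR.
apply: filterS zw => w /normc_dist_lt h.
have hz := le_normcD (z - w) w; have hw := le_normcD (w - z) z.
rewrite subrK in hz; rewrite subrK normc_distC in hw.
rewrite ltr_norml; apply/andP; split; lra.
Qed.

Lemma real_complex_continuous : continuous ((fun r => r%:C%C) : R^o -> R[i]^o).
Proof.
move=> r.
apply/(@cvgrPdist_lt _ (R[i]^o) _ (nbhs r) (nbhs_filter r)) => -[e e'] e0.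
have [e0r e'0] : 0 < e /\ e' = 0 by move: e0; rewrite ltcE /= => /andP[/eqP].
have rs : \forall s \near r, `|r - s| < e.
  exact: (iffLR (@cvgrPdist_lt _ (R^o) _ (nbhs r) (nbhs_filter r) id r)).
apply: filterS rs => s.
by rewrite -rmorphB normc_def /= expr0n addr0 sqrtr_sqr e'0 ltcR.
Qed.

(** The scalar factor is 0 for |z| <= e, rises linearly in |z|, and is 1 for |z| >= 2e. Composed
    with a C_0 function, the cutoff gives a compactly supported function at uniform distance at most
    2e, without creating new nonzero values. *)
Definition cutoff (e : R) (z : R[i]^o) : R[i]^o :=
  (Num.min 1 (Num.max 0 (Normc.normc z / e - 1)))%:C%C * z.

Lemma cutoff_continuous e : continuous (cutoff e).
Proof.
pose h0 (z : R[i]^o) : R^o := Normc.normc z / e - 1.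
have h0c : continuous h0.
  move=> z.
  have h1 := cvgM (FF := nbhs_filter z) (@normc_continuous z)
    (@cst_continuous _ (R^o : topologicalType) e^-1 z).
  have h2 := cvgB (FF := nbhs_filter z) h1
    (@cst_continuous _ (R^o : topologicalType) 1 z).
  exact h2.
pose h : R[i]^o -> R^o := cst 1 \min (cst 0 \max h0).
have hc : continuous h.
  move=> z; apply: (@continuous_min R _ (cst 1) (cst 0 \max h0) z).
    exact: cst_continuous.
  apply: (@continuous_max R _ (cst 0) h0 z); last exact: h0c.
  exact: cst_continuous.
move=> z.
have h1 : (fun w => (h w)%:C%C : R[i]^o) @ z --> ((h z)%:C%C : R[i]^o).
  exact: (continuous_comp (hc z) (@real_complex_continuous (h z))).
have h2 : @idfun (R[i]^o) @ z --> z by exact: cvg_id.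
have h3 := cvgM (FF := nbhs_filter z) h1 h2.
exact h3.
Qed.

Lemma cutoff0 e : cutoff e 0 = 0.
Proof. by rewrite /cutoff mulr0. Qed.

Lemma cutoff_supp e z : 0 < e -> cutoff e z != 0 -> e <= Normc.normc z.
Proof.
move=> e0; apply: contraNT; rewrite -ltNge => ze; apply/eqP.
rewrite /cutoff (max_idPl _) ?(min_idPr _) ?mul0r //.
by rewrite subr_le0 ler_pdivrMr // mul1r ltW.
Qed.

Lemma cutoff_near e z : 0 < e -> Normc.normc (cutoff e z - z) <= 2 * e.
Proof.
move=> e0; have -> : cutoff e z - z =
    (Num.min 1 (Num.max 0 (Normc.normc z / e - 1)) - 1)%:C%C * z.
  by rewrite /cutoff rmorphB mulrBl mul1r.
rewrite Normc.normcM; have n0 := normc_ge0 z.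
set n := Normc.normc z in n0 *; set m := Num.min _ _.
have -> : Normc.normc (m - 1)%:C%C = `|m - 1|.
  by rewrite /Normc.normc /= expr0n addr0 sqrtr_sqr.
have m1 : m <= 1 by rewrite /m ge_min lexx.
have m0 : 0 <= m by rewrite /m le_min ler01 le_max lexx.
rewrite ler0_norm ?subr_le0 // opprB.
have [ne|ne] := leP n (2 * e).
  by rewrite -[leRHS]mul1r ler_pM // ?subr_ge0 // gerBl.
have -> : m = 1.
  rewrite /m; apply: min_idPl; rewrite le_max; apply/orP; right.
  by rewrite lerBrDr ler_pdivlMr // ltW // ne.
by rewrite subrr mul0r mulr_ge0 // ltW.
Qed.

End NormC.

Section C0Bounded.
Variables (R : realType) (X : topologicalType).

Lemma C0_bounded (f : X -> R[i]^o) : C0 f ->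
  exists M, forall x, Normc.normc (f x) <= M.
Proof.
move=> [fc f0]; have [K Kc fK] := f0 1 ltr01.
have gc : continuous (fun x => Normc.normc (f x) : R^o).
  move=> x; apply: (@continuous_comp _ _ _ f); first exact: fc.
  exact: normc_continuous.
have /compact_bounded[M [_ /(_ (M + 1))]] :
    compact ((fun x => Normc.normc (f x) : R^o) @` K).
  by apply: continuous_compact => //; exact: continuous_subspaceT.
rewrite ltrDl ltr01 => /(_ isT) hM.
exists (Num.max (M + 1) 1) => x; rewrite le_max.
have [Kx|/fK/ltW->] := pselect (K x); last by rewrite orbT.
by apply/orP; left; apply: le_trans (ler_norm _) _; apply: hM; exists x.
Qed.

End C0Bounded.

(** * The topology of Omega *)

Section OmegaTopology.
Variable C : category.
Hypothesis C_cancel : left_cancellative C.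
Implicit Types (s t : set (C * C)) (X Y : set C) (chi : cube C).

Lemma cube_nbhs1 chi (Y : @Jset C) :
  nbhs chi [set psi : cube C | psi Y = chi Y].
Proof.
have /cvg_sup/(_ Y) h : nbhs chi --> (chi : cube C) by exact: cvg_id.
apply: h; exists [set psi : cube C | psi Y = chi Y] => //.
split=> //; exists [set chi Y]; first exact: discrete_open.
by apply/seteqP; split.
Qed.

Lemma cube_nbhs chi (r : seq (@Jset C)) :
  nbhs chi [set psi : cube C | forall Z, Z \in r -> psi Z = chi Z].
Proof.
elim: r => [|Y r IHr]; first by apply: filterS filterT => psi _ Z.
apply: filterS2 (cube_nbhs1 chi Y) IHr => psi /= h1 h2 Z.
by rewrite in_cons => /orP[/eqP->//|/h2].
Qed.

Lemma cube_hausdorff : hausdorff_space (cube C).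
Proof.
apply: (@hausdorff_product (@Jset C) (fun=> bool)) => _.
exact: discrete_hausdorff.
Qed.

Lemma cube_compact : compact [set: cube C].
Proof.
have := @tychonoff (@Jset C) (fun=> bool) (fun=> setT) (fun=> bool_compact).
by congr compact; apply/seteqP; split.
Qed.

Lemma cube_zero_dimensional : zero_dimensional (cube C).
Proof.
apply: (@zero_dimension_prod (@Jset C) (fun=> bool)) => _.
exact: discrete_zero_dimension.
Qed.

Lemma Omega_hausdorff : hausdorff_space (Omega C).
Proof. exact/set_type_hausdorff/cube_hausdorff. Qed.

Lemma open_eval (Y : @Jset C) b : open [set chi : cube C | chi Y = b].
Proof. by rewrite openE => chi <-; exact: cube_nbhs1. Qed.

Lemma clopen_Omega_at X : open (Omega_at X) /\ closed (Omega_at X).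
Proof.
have [/(@set_val_surj _ (@Jset C))[Y YX]|nX] := pselect (Jset X); last first.
  have -> : Omega_at X = set0.
    by rewrite -subset0 => chi h; apply: nX; exact: supp_Jset h.
  by split; [exact: open0|exact: closed0].
have E b : open [set chi : Omega C | set_val chi Y = b].
  exact: (@open_set_val _ (@Omega_set C) _ (open_eval Y b)).
have -> : Omega_at X = [set chi : Omega C | set_val chi Y = true].
  by apply/seteqP; split=> chi; rewrite /Omega_at /= -YX => /suppE.
split; first exact: E.
rewrite -openC (_ : ~` _ = [set chi : Omega C | set_val chi Y = false]) //.
apply/seteqP; split=> chi; rewrite /setC /=; first by case: (set_val chi Y).
by move=> ->.
Qed.

(** Being nonzero is not a closed condition, so one coordinate is fixed to 1. Every other instance
    of the axioms involves finitely many coordinates, and is checked on some [psi] in the set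
    agreeing with [chi] on these. *)
Lemma closed_Omega_set_at (Y : @Jset C) :
  closed (@Omega_set C `&` [set chi | chi Y]).
Proof.
move=> chi clchi.
have agree (r : seq (@Jset C)) : exists psi, [/\ Omega_set psi, psi Y &
    forall Z, Z \in r -> psi Z = chi Z].
  by have [psi [[Opsi hY] h]] := clchi _ (cube_nbhs chi r); exists psi.
have supp_val (psi : cube C) Z : supp psi (set_val Z) = psi Z.
  by apply/propext; exact: suppE.
have JP (Z : @Jset C) : Jset (set_val Z) := set_mem (valP Z).
have chiY : chi Y.
  by have [psi [_ hY /(_ Y)]] := agree [:: Y]; rewrite mem_head hY => <-.
split=> //; split.
  split; first by exists Y.
  - move=> X Z; have [W WE] := set_val_surj (Jset_setI C_cancel (JP X) (JP Z)).
    have [psi [[[_ h _] _] _ e]] := agree [:: X; Z; W].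
    have := h X Z; rewrite -WE !supp_val !e //; by rewrite !inE eqxx ?orbT.
  - move=> [Z Z0 hZ]; have [psi [[[_ _ h] _] _ e]] := agree [:: Z].
    by apply: h; exists Z; rewrite // e // mem_head.
move=> X n F X0 F0 XF hX.
have [psi [[_ h] _ e]] := agree (X :: [seq F i | i <- enum 'I_n]).
have [k] := h X n F X0 F0 XF (etrans (e _ (mem_head _ _)) hX).
rewrite e; first by exists k.
by rewrite in_cons map_f ?orbT // mem_enum.
Qed.

Lemma compact_Omega_at X : compact (Omega_at X : set (Omega C)).
Proof.
have [/(@set_val_surj _ (@Jset C))[Y YX]|nX] := pselect (Jset X); last first.
  have -> : Omega_at X = set0.
    by rewrite -subset0 => chi h; apply: nX; exact: supp_Jset h.
  exact: compact0.
have Kc := subclosed_compact (@closed_Omega_set_at Y) cube_compact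
  (@subsetT _ _).
move=> F FF FX.
pose i : Omega C -> cube C := set_val.
have [|chi [[Ochi chiY] clchi]] := Kc (i @ F) (fmap_proper_filter _ FF).
  apply: (@filterS _ F _ _ _ _ FX) => psi.
  rewrite /Omega_at /= -YX => /suppE h; split=> //; exact: set_mem (valP psi).
exists (exist _ chi (mem_set Ochi)); split.
  by rewrite /Omega_at /= -YX; exact/suppE.
move=> A B FA /nbhs_set_val[V [oV Vchi VB]].
have FA' : (i @ F) (i @` A).
  by apply: (@filterS _ F _ _ (i @^-1` _) _ FA) => psi Apsi; exists psi.
have [_ [[psi Apsi <-] Vpsi]] := clchi _ V FA' (open_nbhs_nbhs (conj oV Vchi)).
by exists psi; split=> //; exact: VB.
Qed.

(** A clopen set of the zero-dimensional cube inside the neighbourhood is cut down to the compact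
    open [Omega_at X]. This supplies the compact open sets that index the subbase of the germ
    topology. *)
Lemma Omega_basis (chi : Omega C) (V : set (Omega C)) X : nbhs chi V ->
  Omega_at X chi ->
  exists W, [/\ open W, compact W, W chi, W `<=` V & W `<=` Omega_at X].
Proof.
move=> /nbhs_set_val[V' [oV' V'chi V'V]] hX.
have [D [Dchi [oD cD]] DV'] := zero_dimensional_cvg cube_hausdorff
  cube_zero_dimensional cube_compact (open_nbhs_nbhs (conj oV' V'chi)).
have [oX cX] := clopen_Omega_at X.
have oD' : open (set_val @^-1` D : set (Omega C)) by exact: open_set_val.
have cD' : closed (set_val @^-1` D : set (Omega C)).
  rewrite -openC.
  exact: (@open_set_val _ (@Omega_set C) _ (closed_openC cD)).
exists ((set_val @^-1` D : set (Omega C)) `&` Omega_at X); split.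
- exact: openI.
- apply: (subclosed_compact _ (@compact_Omega_at X)); last by move=> psi [].
  exact: closedI.
- by [].
- by move=> psi [/DV' h _]; exact: V'V.
- by move=> psi [].
Qed.

(** The coordinate of s.chi at [Y] is the coordinate of [chi] at s^-1(Y). With the cube as target,
    the map makes sense on all of Omega, even where s.chi is not a character. *)
Lemma act_continuous s : Il s ->
  continuous (fun chi : Omega C => act s (set_val chi) : cube C).
Proof.
move=> ss chi.
have FF := @fmap_filter _ _ (fun psi : Omega C => act s (set_val psi) : cube C)
  _ (nbhs_filter chi).
apply/cvg_sup => Y W.
move=> [_ [[B oB <-] /= Bchi] BW].
have [Z ZE] := set_val_surj (Jset_ppreim ss (set_mem (valP Y))).
have aE psi : act s psi Y = psi Z.
  rewrite /act -ZE; apply/idP/idP => [/asboolP/suppE//|/suppE h].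
  exact/asboolP.
have : nbhs chi [set psi : Omega C | set_val psi Z = set_val chi Z].
  apply/nbhs_set_val; exists [set psi : cube C | psi Z = set_val chi Z].
  split=> //.
  exact: open_eval.
apply: filterS => psi /= e; apply: BW => /=.
by move: Bchi; rewrite /preimage /= !aE e.
Qed.

End OmegaTopology.

(** * Transformation groupoids *)

Section TransformationGroupoid.
Variables (U : groupType) (X : topologicalType) (theta : U -> set (X * X)).
Hypothesis theta_pa : is_partial_action theta.
Local Notation T := (transformation_groupoid theta).

Lemma pa_fun g x y z : theta g (x, y) -> theta g (x, z) -> y = z.
Proof. by case: theta_pa => h _ _ _ _; exact: h. Qed.

Lemma pa_inv g x y : theta (g^-1)%g (x, y) <-> theta g (y, x).
Proof. by case: theta_pa => _ _ -> _ _. Qed.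

Lemma pa_comp g h x y z : theta h (x, y) -> theta g (y, z) ->
  theta (g * h)%g (x, z).
Proof. by case: theta_pa => _ _ _ H _ hxy gyz; apply: H; exists y. Qed.

Lemma pa_open g (V : set X) : open V -> open (ppreim (theta g) V).
Proof. by case: theta_pa => _ _ _ _ [_ h]; exact: h. Qed.

Definition telt (p : T) : U := (set_val p).1.
Definition tsrc (p : T) : X := (set_val p).2.

Lemma trng_subproof p : exists y, theta (telt p) (tsrc p, y).
Proof. exact: (set_mem (valP p)). Qed.

Definition trng p : X := projT1 (cid (trng_subproof p)).

Lemma trngP p : theta (telt p) (tsrc p, trng p).
Proof. by rewrite /trng; case: cid. Qed.

Lemma trngE p y : theta (telt p) (tsrc p, y) -> trng p = y.
Proof. exact/pa_fun/trngP. Qed.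

Lemma arrow_pair p : set_val p = (telt p, tsrc p).
Proof. exact: surjective_pairing. Qed.

Lemma arrow_inj p q : telt p = telt q -> tsrc p = tsrc q -> p = q.
Proof.
by move=> e1 e2; apply: val_inj; rewrite [LHS]arrow_pair [RHS]arrow_pair e1 e2.
Qed.

Lemma arrow_exists g x y : theta g (x, y) ->
  exists p : T, [/\ telt p = g, tsrc p = x & trng p = y].
Proof.
move=> gxy; have h : pdom (theta g) x by exists y.
pose q : discrete_topology U * X := (g, x).
have hq : q \in [set p : discrete_topology U * X | pdom (theta p.1) p.2].
  exact: mem_set.
by exists (exist _ q hq); split=> //; apply: trngE.
Qed.

(** U is discrete, so a basic neighbourhood freezes the group element and moves only the source. *)
Lemma nbhs_arrow (p : T) (A : set T) : nbhs p A <->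
  exists V, [/\ open V, V (tsrc p) &
    forall q, telt q = telt p -> V (tsrc q) -> A q].
Proof.
split=> [/nbhs_set_val[W [oW Wp WA]]|[V [oV Vp VA]]].
  have : nbhs (set_val p) W by apply: open_nbhs_nbhs.
  move=> [[B1 B2] /= [n1 n2] B12].
  move: n2; rewrite nbhsE => -[V [oV Vp] VB2].
  exists V; split=> // q qp Vq; apply: WA; apply: B12; split => /=.
    rewrite [_.1]qp; exact: nbhs_singleton n1.
  exact: VB2.
apply/nbhs_set_val; exists ([set telt p] `*` V); split.
- rewrite openE => -[g x] /= [-> Vx].
  exists ([set telt p], V) => //=; split; first exact: discrete_set1.
  exact: open_nbhs_nbhs.
- by [].
- by move=> q [/= qp Vq]; exact: VA.
Qed.

Lemma trng_continuous : continuous trng.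
Proof.
move=> p W; rewrite nbhsE => -[V [oV Vp] VW]; apply/nbhs_arrow.
exists (ppreim (theta (telt p)) V); split; first exact: pa_open.
  by exists (trng p) => //; exact: trngP.
move=> q qp [y Vy qy]; apply: VW.
by rewrite (trngE (y := y)) // qp.
Qed.

Lemma nbhs_arrow_telt (p : T) (A : set T) :
  (forall q, telt q = telt p -> A q) ->
  nbhs p A.
Proof.
move=> h; apply/nbhs_arrow; exists setT; split=> //; first exact: openT.
by move=> q /h.
Qed.

Lemma fiberwise_continuous (Y : topologicalType) (b : U -> X -> Y) :
  (forall g, continuous (b g)) ->
  continuous (fun p => b (telt p) (trng p)).
Proof.
move=> bc p W Wp; have /(_ _ Wp) := @bc (telt p) (trng p).
move=> /trng_continuous; apply: filterS2 (nbhs_arrow_telt _) => [q h|].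
  exact: h.
by move=> q qp; rewrite /preimage /= qp.
Qed.

(** On the arrows over [g], the range map is a homeomorphism onto im(theta_g), its inverse coming
    from theta at g^-1; a cluster point of the ranges therefore lifts. *)
Lemma compact_fiber g (K : set X) : compact K -> K `<=` pim (theta g) ->
  compact [set p : T | telt p = g /\ K (trng p)].
Proof.
move=> Kc Kg F FF FD.
have [|y [Ky yF]] := Kc (trng @ F) (fmap_proper_filter _ FF).
  by apply: (@filterS _ F _ _ (trng @^-1` K) _ FD) => p [].
have [x gxy] := Kg _ Ky; have [p [pg px py]] := arrow_exists gxy.
exists p; split; first by split=> //; rewrite py.
move=> A B FA /nbhs_arrow[V [oV Vp VB]].
have nV : nbhs y (ppreim (theta (g^-1)%g) V).
  apply: open_nbhs_nbhs; split; first exact: pa_open.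
  by exists x; [rewrite -px|apply/pa_inv].
have FA' : (trng @ F) (trng @` (A `&` [set p : T | telt p = g /\ K (trng p)])).
  apply: (@filterS _ F _ _ (trng @^-1` _) _ (filterI FA FD)) => q Aq.
  by exists q.
have [_ [[q [Aq [qg _]] <-] [z Vz /pa_inv gz]]] := yF _ _ FA' nV.
exists q; split=> //; apply: VB; first by rewrite qg pg.
suff -> : tsrc q = z by [].
apply: (@pa_fun g^-1%g (trng q)); apply/pa_inv => //.
by rewrite -qg; exact: trngP.
Qed.

Lemma closed_telt g : closed [set p : T | telt p = g].
Proof.
rewrite -openC openE => p /= pg; apply: nbhs_arrow_telt => q /=.
by rewrite /setC /= => ->.
Qed.

(** [telt] is locally constant. The near-covering form of compactness is applied to the filter of
    finite subsets of U ordered by inclusion, and yields one finite set containing all values. *)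
Lemma compact_telt (K : set T) : compact K -> finite_set (telt @` K).
Proof.
move=> /compact_near_coveringP Kc.
have tot : Filter (@totally U) := @filter_filter _ _ totally_filter.
have := Kc _ totally (fun (A : {fset U}) p => telt p \in A) tot.
case=> [p _|A _ KA].
  exists ([set q : T | telt q = telt p],
          [set A : {fset U} | telt p \in A]) => /=.
    split; first exact: nbhs_arrow_telt.
    by exists [fset telt p]%fset => // A; rewrite /= fsub1set.
  by move=> [q A] /= [-> h].
apply: (@sub_finite_set _ _ [set` A]); last exact: finite_fset.
by move=> _ [p Kp <-] /=; apply: (KA A) => //=; exact: fsubset_refl.
Qed.

End TransformationGroupoid.
Arguments nbhs_arrow {U X theta} p A.
Arguments telt {U X theta} p.
Arguments tsrc {U X theta} p.
Arguments trng {U X theta} p.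

(** * The canonical partial action *)

Section Germs.
Variable C : category.
Hypothesis C_cancel : left_cancellative C.
Implicit Types (s t : set (C * C)) (chi : Omega C).

Lemma Omega_character chi : is_character (set_val chi).
Proof. by have [] : Omega_set (set_val chi) := set_mem (valP chi). Qed.

Lemma germ_eq_refl chi s : Omega_at (pdom s) chi -> germ_eq chi s s.
Proof. by move=> h; exists (pdom s) => // x [y xy]; exists y. Qed.

Lemma germ_eq_sym chi s t : germ_eq chi s t -> germ_eq chi t s.
Proof. by move=> [X hX st]; exists X => // x /st[y []]; exists y. Qed.

Lemma germ_eq_trans chi s t u : Il t ->
  germ_eq chi s t -> germ_eq chi t u -> germ_eq chi s u.
Proof.
move=> tt [X hX st] [Y hY tu]; exists (X `&` Y).
  exact: (supp_setI (Omega_character chi) hX hY).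
move=> x [/st[y [sxy txy]] /tu[z [txz uxz]]]; exists y; split=> //.
by rewrite (Il_fun C_cancel tt txy txz).
Qed.

Lemma germ_class_eq chi s t : Il s -> Il t ->
  germ_eq chi s t -> germ_class chi s = germ_class chi t.
Proof.
move=> ss tt st; apply/seteqP; split=> u [uu du h]; split=> //.
  exact: (germ_eq_trans ss (germ_eq_sym st) h).
exact: (germ_eq_trans tt st h).
Qed.

Lemma germ_exists s chi : Il s -> Omega_at (pdom s) chi ->
  exists a : germ C, is_germ s chi a.
Proof.
move=> ss sd.
have h : exists u, [/\ Il u, Omega_at (pdom u) chi &
    germ_class chi s = germ_class chi u] by exists s.
by exists (exist _ (chi, germ_class chi s) (mem_set h)).
Qed.

Lemma germP (a : germ C) : exists s chi, is_germ s chi a.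
Proof.
have [s [ss sd e]] := set_mem (valP a).
by exists s, (set_val a).1; split=> //; rewrite -e -surjective_pairing.
Qed.

Lemma is_germ_eq s t chi psi (a : germ C) :
  is_germ s chi a -> is_germ t psi a ->
  chi = psi /\ germ_eq chi s t.
Proof.
move=> [ss sd e] [tt td]; rewrite e => -[e1 e2]; split=> //.
have : germ_class psi t t by split=> //; exact: germ_eq_refl.
by rewrite -e2 => -[].
Qed.

Lemma is_germ_inj s t chi (a b : germ C) : is_germ s chi a -> is_germ t chi b ->
  germ_eq chi s t -> a = b.
Proof.
by move=> [ss sd e1] [tt td e2] st; apply: val_inj; rewrite [LHS]e1 [RHS]e2
  (germ_class_eq ss tt st).
Qed.

Lemma germ_eq_nonempty chi s t : germ_eq chi s t -> exists p, s p /\ t p.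
Proof.
move=> [X /(supp_nonempty (Omega_character chi))[x Xx] /(_ _ Xx)[y []]].
by exists (x, y).
Qed.

Lemma germ_eq_act chi s t : Il s -> Il t -> germ_eq chi s t ->
  act s (set_val chi) = act t (set_val chi).
Proof.
move=> ss tt [X hX]; exact: (act_agree C_cancel ss tt (Omega_character chi) hX).
Qed.

Lemma germ_subbase_open sU : germ_subbase_index sU ->
  open (@germ_subbase C sU).
Proof.
move=> h; exists [set germ_subbase sU].
  move=> _ ->; exists [fset sU]%fset.
    by move=> tV; rewrite inE => /eqP ->; exact/mem_set.
  apply/seteqP; split=> [a /(_ sU)|a h' tV /=]; first by apply; rewrite /= inE.
  by rewrite inE => /eqP->.
by apply/seteqP; split=> [a [_ ->]|a]; last exists (germ_subbase sU).
Qed.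

Lemma continuous_germ (Y : topologicalType) (f : Y -> germ C) :
  (forall sU, germ_subbase_index sU -> open (f @^-1` germ_subbase sU)) ->
  continuous f.
Proof.
move=> fo; apply/continuousP => _ [D' D'D <-].
rewrite preimage_bigcup; apply: bigcup_open => A /D'D[E Esub <-].
rewrite preimage_bigcap openE => y yE.
apply: filter_bigI => i iE; apply: open_nbhs_nbhs; split; last exact: yE.
by apply: fo; exact/set_mem/Esub.
Qed.

End Germs.

Section CanonicalAction.
Variables (C : category) (G : groupoid) (rho : C -> G).
Variables (U : groupType) (j : G -> U).
Hypothesis rho_emb : is_embedding rho.
Hypothesis jU : is_universal_group j.
Implicit Types (s t : set (C * C)) (chi : Omega C).

Local Notation lam := (fun x : C => j (rho x)).

Lemma lam_comp (c d : C) : cdom c = ctgt d ->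
  lam (ccomp c d) = (lam c * lam d)%g.
Proof.
move=> cd; case: rho_emb jU => -[rd rt rc] _ [jF _].
by rewrite rc // jF // rd rt cd.
Qed.

Lemma lam_inj (x y : C) : cdom x = cdom y -> lam x = lam y -> x = y.
Proof.
case: rho_emb => -[rd _ _] rinj xy /(universal_group_inj jU) h.
by apply/rinj/h; rewrite !rd xy.
Qed.

Lemma embedded_left_cancellative : left_cancellative C.
Proof.
move=> c x y cx cy e; apply: lam_inj.
  by rewrite -(cdom_comp (esym cx)) e cdom_comp.
by apply: (mulgI (lam c)); rewrite -!lam_comp // e.
Qed.

(* Elements of I_l act as restrictions of left translations by elements of U. *)
Definition translates s (g : U) := forall x y, s (x, y) ->
  cdom y = cdom x /\ lam y = (g * lam x)%g.

Lemma translates_inv s g :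
  translates s g -> translates (s^-1)%relation (g^-1)%g.
Proof. by move=> sg x y /= /sg[-> ->]; rewrite mulKg. Qed.

Lemma translates_comp s t g h : translates s g -> translates t h ->
  translates (s \; t)%relation (g * h)%g.
Proof.
by move=> sg th x y [z /= /th[e1 e2] /sg[-> ->]]; rewrite e1 e2 mulgA.
Qed.

Lemma Il_translates s : Il s -> exists g, translates s g.
Proof.
elim=> [c|{}s _ [g sg]|{}s t _ [g sg] _ [h th]].
- exists (lam c) => x _ [/= xc ->].
  by rewrite cdom_comp // lam_comp.
- by exists (g^-1)%g; exact: translates_inv.
- by exists (g * h)%g; exact: translates_comp.
Qed.

(** Defined by the translating element rather than by words, so that well-definedness is just
    [translates_unique]. Every group element translates the empty relation, where 1 is a dummy
    value. *)
Definition rhobar s : U :=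
  if pselect (exists g, translates s g /\ s !=set0) is left e
  then projT1 (cid e) else 1%g.

Lemma translates_unique s g h : s !=set0 -> translates s g -> translates s h ->
  g = h.
Proof.
move=> [[x y] xy] /(_ _ _ xy)[_ e] /(_ _ _ xy)[_]; rewrite e; exact: mulIg.
Qed.

Lemma rhobarE s g : s !=set0 -> translates s g -> rhobar s = g.
Proof.
move=> s0 sg; rewrite /rhobar; case: pselect => [e|[]]; last by exists g.
by case: cid => h /= [sh _]; exact: (translates_unique s0 sh sg).
Qed.

Lemma translates_rhobar s : Il s -> s !=set0 -> translates s (rhobar s).
Proof. by move=> /Il_translates[g sg] s0; rewrite (rhobarE s0 sg). Qed.

Lemma rhobar_comp s t : Il s -> Il t -> (s \; t)%relation !=set0 ->
  rhobar (s \; t)%relation = (rhobar s * rhobar t)%g.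
Proof.
move=> ss tt st0; apply: rhobarE => //; have [[x y] [z /= xz zy]] := st0.
apply: translates_comp; apply: translates_rhobar => //; first by exists (z, y).
by exists (x, z).
Qed.

Lemma rhobar_inv s : Il s -> s !=set0 ->
  rhobar (s^-1)%relation = (rhobar s)^-1%g.
Proof.
move=> ss s0; apply: rhobarE; last exact/translates_inv/translates_rhobar.
by case: s0 => -[x y]; exists (y, x).
Qed.

Lemma Il_zigzag p w : Il (zigzag p w : set (C * C)).
Proof.
have Ilq (q : C * C) : Il ((lmul q.1)^-1 \; lmul q.2)%relation.
  exact: (Il_mul (Il_inv (Il_lmul _)) (Il_lmul _)).
by elim: w p => [|q w IHw] p /=; [exact: Ilq|exact: (Il_mul (Ilq p) (IHw q))].
Qed.

(** The clause on the target serves the induction: it shows that the factors of [gzigzag] are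
    composable, which a pair in the graph of the zigzag guarantees. *)
Lemma zigzag_translates p w x y : zigzag p w (x, y) ->
  ctgt (gzigzag rho p w) = rho (ctgt y) /\
  lam y = (j (gzigzag rho p w) * lam x)%g.
Proof.
case: rho_emb => -[rd rt rc] _; case: (jU) => jF _.
have step (q : C * C) z u : ((lmul q.1)^-1 \; lmul q.2)%relation (z, u) ->
    let dc := ccomp (ginv (rho q.1)) (rho q.2) in
    [/\ ctgt dc = rho (ctgt u), cdom dc = rho (ctgt z)
      & lam u = (j dc * lam z)%g].
  move=> [v [/= zc vE] [/= ud vE']].
  have dom : cdom (ginv (rho q.1)) = ctgt (rho q.2).
    rewrite gdom_inv !rt -(ctgt_comp (esym ud)) -vE' vE.
    by rewrite (ctgt_comp (esym zc)).
  rewrite ctgt_comp // cdom_comp // gtgt_inv !rd jF //.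
  rewrite (functor_to_group_inv jU).
  split; rewrite ?ud ?zc // -mulgA -lam_comp // -vE vE' lam_comp //.
  by rewrite mulKg.
elim: w p y => [|q w IHw] p y /=; first by move=> /step[].
move=> [z /= /IHw[e1 e2] /step[e3 e4 e5]].
have dom : cdom (ccomp (ginv (rho p.1)) (rho p.2)) = ctgt (gzigzag rho q w).
  by rewrite e1 e4.
by rewrite ctgt_comp // e3 jF // e5 e2 mulgA.
Qed.

Lemma rhobarP : is_rhobar rho j rhobar.
Proof.
split=> [p w /eqP/set0P s0|s t ss tt /eqP/set0P]; last exact: rhobar_comp.
have [[x y] xy] := s0; have h := translates_rhobar (Il_zigzag p w) s0.
have [_ e] := h x y xy; have [_] := zigzag_translates xy; rewrite e.
exact: mulIg.
Qed.

Let cancelC := embedded_left_cancellative.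

(** On the common domain both maps are translation by the same element and preserve sources, so
    [lam_inj] makes them agree. This is the step that turns germs into pairs. *)
Lemma rhobar_eq_germ s t chi : Il s -> Il t -> Omega_at (pdom s) chi ->
  Omega_at (pdom t) chi -> rhobar s = rhobar t -> germ_eq chi s t.
Proof.
move=> ss tt sd td e; exists (pdom s `&` pdom t).
  exact: (supp_setI (Omega_character chi) sd td).
move=> x [[y xy] [z xz]]; exists y; split=> //.
suff -> : y = z by [].
have [d1 l1] := translates_rhobar ss (ex_intro _ _ xy) xy.
have [d2 l2] := translates_rhobar tt (ex_intro _ _ xz) xz.
by apply: lam_inj; rewrite ?d1 ?d2 // l1 l2 e.
Qed.

Lemma germ_eq_rhobar s t chi : Il s -> Il t -> germ_eq chi s t ->
  rhobar s = rhobar t.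
Proof.
move=> ss tt /germ_eq_nonempty[[x y] [sxy txy]].
have [_ l1] := translates_rhobar ss (ex_intro _ _ sxy) sxy.
have [_ l2] := translates_rhobar tt (ex_intro _ _ txy) txy.
by apply: (mulIg (lam x)); rewrite -l1 -l2.
Qed.

Lemma Omega_at_nonempty s chi : Omega_at (pdom s) chi -> s !=set0.
Proof.
by move=> /(supp_nonempty (Omega_character chi))[x [y xy]]; exists (x, y).
Qed.

Definition canonical_action (g : U) : set (Omega C * Omega C) :=
  [set p | exists s, [/\ Il s, rhobar s = g, Omega_at (pdom s) p.1 &
                         set_val p.2 = act s (set_val p.1)]].

Lemma canonical_actionE s chi psi : Il s -> Omega_at (pdom s) chi ->
  canonical_action (rhobar s) (chi, psi) <-> set_val psi = act s (set_val chi).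
Proof.
move=> ss sd; split=> [[t [tt e /= td ->]]|h]; last by exists s.
by apply: (germ_eq_act cancelC tt ss); exact: rhobar_eq_germ.
Qed.

Lemma act_OmegaP s chi : Il s -> Omega_at (pdom s) chi ->
  exists psi : Omega C, set_val psi = act s (set_val chi).
Proof.
move=> ss sd.
exact: (set_val_surj (act_Omega cancelC ss (set_mem (valP chi)) sd)).
Qed.

Lemma canonical_action_pdom g : pdom (canonical_action g) =
  \bigcup_(s in [set s | [/\ Il s, s <> set0 & rhobar s = g]])
    Omega_at (pdom s).
Proof.
apply/seteqP; split=> [chi [psi [s [ss e /= sd _]]]|chi [s [ss _ e] sd]].
  by exists s => //; split=> //; apply/eqP/set0P; exact: (Omega_at_nonempty sd).
by have [psi h] := act_OmegaP ss sd; exists psi, s.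
Qed.

Lemma canonical_action_inv g chi psi : canonical_action g (chi, psi) ->
  canonical_action (g^-1)%g (psi, chi).
Proof.
move=> [s [ss <- /= sd e]]; exists (s^-1)%relation; split.
- exact: Il_inv.
- exact/rhobar_inv/(Omega_at_nonempty sd).
- by rewrite /Omega_at /= e; exact: supp_act_pim.
- by rewrite /= e (act_inv cancelC ss (Omega_character chi) sd).
Qed.

Lemma canonical_action_comp g h chi psi phi : canonical_action h (chi, psi) ->
  canonical_action g (psi, phi) -> canonical_action (g * h)%g (chi, phi).
Proof.
move=> [t [tt <- /= td e1]] [s [ss <- /= sd e2]]; exists (s \; t)%relation.
have d : Omega_at (pdom (s \; t)%relation) chi.
  move: sd; rewrite /Omega_at /= e1 supp_act //; last exact: Jset_pdom.
  by rewrite ppreim_pdom.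
split=> //=; first exact: Il_mul.
  exact: (rhobar_comp ss tt (Omega_at_nonempty d)).
by rewrite e2 e1 act_comp.
Qed.

Lemma canonical_action_partial : is_partial_action canonical_action.
Proof.
have dom_open g : open (pdom (canonical_action g)).
  rewrite canonical_action_pdom; apply: bigcup_open => s _.
  exact: (clopen_Omega_at (pdom s)).1.
split=> //.
- move=> g chi psi phi [s [ss <- /= sd e1]] /(canonical_actionE _ ss sd) e2.
  by apply: val_inj; rewrite [LHS]e1.
- apply/seteqP; split=> [[chi psi] [s [ss s1 /= sd e]]|[chi _] /= <-].
    (* An [s] over 1 is a restriction of the identity, hence acts on [chi] as the idempotent s^-1 s
       does. *)
    have h : act s (set_val chi) = set_val chi.
      rewrite -[RHS](act_idem cancelC ss (Omega_character chi) sd).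
      apply: (act_agree cancelC ss _ (Omega_character chi) sd).
        exact: (Il_mul (Il_inv ss) ss).
      move=> x [y xy]; exists y; split=> //.
      have [d l] := translates_rhobar ss (ex_intro _ _ xy) xy.
      have yx : y = x by apply: lam_inj; rewrite ?d // l s1 mul1g.
      by exists y => //=; rewrite -{1}yx in xy *; rewrite yx in xy *.
    by apply: val_inj; rewrite [RHS]e h.
  (* A character is nonzero, so it lives on some dom(s); the idempotent s^-1 s then lies over 1 and
     fixes it. *)
  have [[X hX] _ _] := Omega_character chi.
  have [s ss Xs] := set_mem (valP X).
  have sd : Omega_at (pdom s) chi by rewrite /Omega_at /= -Xs; exact/suppE.
  have s0 := Omega_at_nonempty sd.
  have d : pdom (s^-1 \; s)%relation = pdom s.
    apply/seteqP; split=> [x [y [z /= xz _]]|x [z xz]]; first by exists z.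
    by exists x, z.
  exists (s^-1 \; s)%relation; split.
  + exact: (Il_mul (Il_inv ss) ss).
  + rewrite rhobar_comp ?rhobar_inv ?mulVg //; first exact: Il_inv.
    by case: s0 => -[x z] xz; exists (x, x), z.
  + by rewrite d.
  + exact: (esym (act_idem cancelC ss (Omega_character chi) sd)).
- move=> g; apply/seteqP; split=> -[chi psi] /= /canonical_action_inv //.
  by rewrite invgK.
- by move=> g h [chi phi] [psi /= h1 h2]; exact: (canonical_action_comp h1 h2).
- split=> // g _ /open_set_valP[V oV ->].
  (* Over each [s] above [g], the action of [g] is the continuous map [act s] on the open set
     [Omega_at (pdom s)]. *)
  rewrite (_ : ppreim _ _ = \bigcup_(s in [set s | Il s /\ rhobar s = g])
    (Omega_at (pdom s) `&`
     (fun chi : Omega C => act s (set_val chi) : cube C) @^-1` V)).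
    apply: bigcup_open => s [ss _]; apply: openI.
      exact: (clopen_Omega_at (pdom s)).1.
    have /continuousP := act_continuous ss.
    exact.
  apply/seteqP; split=> chi.
    move=> [psi Vpsi [s [ss sg /= sd e]]].
    by exists s => //; split=> //; rewrite /preimage /= -e.
  move=> [s [ss sg] [sd Vchi]].
  have [psi e] := act_OmegaP ss sd; exists psi; first by rewrite /preimage /= e.
  by exists s.
Qed.

Lemma canonical_actionP : is_canonical_action rhobar canonical_action.
Proof.
split; [exact: canonical_action_partial|exact: canonical_action_pdom|].
by move=> s chi psi ss _ sd /canonical_actionE-> //.
Qed.

End CanonicalAction.

(** * The reduced crossed product *)

Lemma esum_scale_le (R : realType) (I : choiceType) (c : R) (a : I -> \bar R) :
  0 <= c -> (forall i, 0 <= a i)%E ->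
  (\esum_(i in [set: I]) (c%:E * a i) <= c%:E * \esum_(i in [set: I]) a i)%E.
Proof.
move=> c0 a0; apply: ge_ereal_sup => _ [A [finA _] <-].
rewrite -ge0_mule_fsumr //.
by rewrite lee_wpmul2l ?lee_fin //; apply: ereal_sup_ubound; exists A.
Qed.

Lemma sqr_normc_sum (R : realType) (I : Type) (s : seq I) (z : I -> R[i]) :
  Normc.normc (\sum_(i <- s) z i) ^+ 2 <=
  (2 ^ size s)%:R * \sum_(i <- s) Normc.normc (z i) ^+ 2.
Proof.
elim: s => [|i s IHs]; first by rewrite !big_nil Normc.normc0 expr0n mulr0.
rewrite !big_cons /= expnS natrM.
set w := \sum_(j <- s) z j in IHs *; set b := \sum_(j <- s) _ in IHs *.
have b0 : 0 <= b by apply: sumr_ge0 => j _; exact: sqr_ge0.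
have k1 : 1 <= (2 ^ size s)%:R :> R by rewrite ler1n expn_gt0.
have : Normc.normc (z i + w) ^+ 2 <= (Normc.normc (z i) + Normc.normc w) ^+ 2.
  rewrite ler_pXn2r ?nnegrE ?addr_ge0 ?normc_ge0 //; exact: le_normcD.
move: (Normc.normc (z i + w) ^+ 2) (Normc.normc (z i)) (Normc.normc w) IHs.
move=> c a n IHs h; move: (2 ^ size s)%:R k1 IHs => k k1 IHs.
have := ler_wpM2r (sqr_ge0 a) k1; rewrite mul1r => ka.
by have := sqr_ge0 (a - n); rewrite sqrrB; rewrite sqrrD in h; lra.
Qed.

Section CrossedFormula.
Variables (R : realType) (U : groupType) (X : topologicalType).
Variable theta : U -> set (X * X).
Hypothesis theta_pa : is_partial_action theta.
Local Notation T := (transformation_groupoid theta).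
Implicit Types (a b : U -> X -> R[i]^o) (xi : X * U -> R[i]^o).

Lemma crossed_formulaE a xi x k y : theta k (x, y) ->
  crossed_formula theta a xi (x, k) =
  \sum_(g \in [set: U]) a g y * xi (x, (g^-1 * k)%g).
Proof.
move=> kxy; rewrite /crossed_formula /=.
rewrite (@reindex_fsbig _ _ _ _ _ (fun g => (g, y)) [set: U]) //.
split=> [g _ //|g h _ _ [] //|[g z] /= kxz].
by exists g => //; rewrite (pa_fun theta_pa kxy kxz).
Qed.

Lemma crossed_formula_out a xi x k : (forall y, ~ theta k (x, y)) ->
  crossed_formula theta a xi (x, k) = 0.
Proof. by move=> nk; rewrite /crossed_formula fsbig1 // => -[g y] /nk. Qed.

Lemma crossed_formula_seq a xi (s : {fset U}) x k y : theta k (x, y) ->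
  (forall g, g \notin s -> a g = 0) ->
  crossed_formula theta a xi (x, k) =
  \sum_(g <- s) a g y * xi (x, (g^-1 * k)%g).
Proof.
move=> kxy sa; rewrite (crossed_formulaE _ _ kxy); apply: fsbigTE => g /sa ->.
by rewrite mul0r.
Qed.

Lemma crossed_formula_lin a (c : R[i]) xi eta (s : {fset U}) xk :
  (forall g, g \notin s -> a g = 0) ->
  crossed_formula theta a (c *: xi + eta) xk =
  c * crossed_formula theta a xi xk + crossed_formula theta a eta xk.
Proof.
case: xk => x k sa; have [[y kxy]|nk] := pselect (exists y, theta k (x, y)).
  rewrite !(crossed_formula_seq _ kxy sa) mulr_sumr -big_split.
  by apply: eq_bigr => g _ /=; rewrite mulrDr mulrCA.
by rewrite !crossed_formula_out ?mulr0 ?addr0 // => y h; case: nk; exists y.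
Qed.

Lemma crossed_formulaB a b xi (s : {fset U}) xk :
  (forall g, g \notin s -> a g = 0) -> (forall g, g \notin s -> b g = 0) ->
  crossed_formula theta (fun g y => a g y - b g y) xi xk =
  crossed_formula theta a xi xk - crossed_formula theta b xi xk.
Proof.
case: xk => x k sa sb; have [[y kxy]|nk] := pselect (exists y, theta k (x, y)).
  have sab g : g \notin s -> (fun y => a g y - b g y) = 0.
    by move=> gs; apply/funext => z; rewrite sa // sb // subrr.
  rewrite (crossed_formula_seq _ kxy sab) (crossed_formula_seq _ kxy sa).
  rewrite (crossed_formula_seq _ kxy sb) -sumrB.
  by apply: eq_bigr => g _ /=; rewrite mulrBl.
by rewrite !crossed_formula_out ?subr0 // => y h; case: nk; exists y.
Qed.

(* A crude bound, obtained from |z + w|^2 <= 2 |z|^2 + 2 |w|^2: only its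
   dependence on [s] alone matters. *)
Definition support_const (s : {fset U}) : R := (size s * 2 ^ size s)%:R.

Lemma sqnorm_crossed_formula a (xi : L2 R (X * U)%type) (s : {fset U}) (M : R) :
  (forall g, g \notin s -> a g = 0) ->
  (forall g y, Normc.normc (a g y) <= M) ->
  (sqnorm (crossed_formula theta a xi) <=
     ((support_const s * M) ^+ 2)%:E * sqnorm xi)%E.
Proof.
move=> sa aM; pose c : R := (2 ^ size s)%:R * M ^+ 2.
have c0 : 0 <= c by rewrite mulr_ge0 ?sqr_ge0.
pose n2 g (xk : X * U) : \bar R :=
  ((Normc.normc (xi (xk.1, (g^-1 * xk.2)%g))) ^+ 2)%:E.
have n20 g xk : (0 <= n2 g xk)%E by rewrite lee_fin sqr_ge0.
have cn20 g xk : (0 <= c%:E * n2 g xk)%E by rewrite mule_ge0 // lee_fin.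
(* Left translation of the second coordinate permutes X x U, so each term keeps the norm of [xi]. *)
have n2E g : (\esum_(xk in [set: X * U]) n2 g xk)%E = sqnorm xi.
  rewrite /sqnorm [RHS](@reindex_esum _ _ _ [set: X * U] _
    (fun xk => (xk.1, (g^-1 * xk.2)%g))) //; split=> //.
    by move=> [x k] [x' k'] _ _ [-> /mulgI ->].
  by move=> [x k] _; exists (x, (g * k)%g) => //=; rewrite mulKg.
apply: (@le_trans _ _
  (\esum_(xk in [set: X * U]) \sum_(g <- s) c%:E * n2 g xk)%E).
  apply: le_esum => -[x k] _.
  have [[y kxy]|nk] := pselect (exists y, theta k (x, y)); last first.
    rewrite crossed_formula_out => [|y h]; last by case: nk; exists y.
    by rewrite Normc.normc0 expr0n; apply: sume_ge0.
  rewrite (crossed_formula_seq _ kxy sa) /n2 /=.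
  under [leRHS]eq_bigr do rewrite -EFinM.
  rewrite sumEFin lee_fin; apply: le_trans (sqr_normc_sum _ _) _.
  rewrite mulr_sumr; apply: ler_sum => g _.
  rewrite /c -mulrA Normc.normcM exprMn ler_wpM2l // ler_wpM2r ?sqr_ge0 //.
  have := aM g y; have := normc_ge0 (a g y).
  move: (Normc.normc (a g y)) => r r0 rM.
  by rewrite ler_pXn2r ?nnegrE // (le_trans r0).
rewrite esum_sum //.
apply: (@le_trans _ _ (\sum_(g <- s) c%:E * sqnorm xi)%E).
  apply: lee_sum => g _; rewrite -(n2E g); exact: esum_scale_le.
rewrite -sqr_l2norm -!EFinM sumEFin lee_fin.
rewrite big_const_seq count_predT iter_addr_0.
rewrite -mulr_natl mulrA ler_wpM2r ?sqr_ge0 // /c /support_const exprMn mulrA.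
rewrite ler_wpM2r ?sqr_ge0 // -natrM -natrX ler_nat.
(* A natural number is at most its square; this brings the bound to the squared form that
   [l2norm_le] expects. *)
by case: (_ * _)%N => // n; rewrite -mulnn leq_pmulr.
Qed.

Section Bounded.
Variables (a : U -> X -> R[i]^o) (s : {fset U}) (M : R).
Hypotheses (sa : forall g, g \notin s -> a g = 0).
Hypothesis aM : forall g y, Normc.normc (a g y) <= M.

Lemma crossed_rep_val (xi : L2 R (X * U)%type) xk :
  crossed_rep theta a xi xk = crossed_formula theta a xi xk.
Proof.
rewrite toL2E //; apply: le_lt_trans (sqnorm_crossed_formula xi sa aM) _.
by rewrite -sqr_l2norm -EFinM ltry.
Qed.

Lemma opnorm_crossed_rep :
  opnorm_le (crossed_rep theta a) (support_const s * M).
Proof.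
(* When [X] is empty, [M] may be negative; the Hilbert space is then zero. *)
move=> xi; have [x0|nx] := pselect (exists x : X, True); last first.
  have z0 (eta : L2 R (X * U)%type) : eta = 0.
    by apply: L2_eqP => -[x k]; case: nx; exists x.
  rewrite (z0 xi) (z0 (crossed_rep _ _ _)).
  by rewrite l2norm0 mulr0.
have M0 : 0 <= M.
  by case: x0 => x _; apply: le_trans (aM 1%g x); exact: normc_ge0.
apply: l2norm_le; first by rewrite mulr_ge0 // ler0n.
have -> : L2_val (crossed_rep theta a xi) = crossed_formula theta a xi.
  by apply/funext => xk; exact: crossed_rep_val.
exact: sqnorm_crossed_formula.
Qed.

Lemma crossed_rep_bounded : bounded_operator (crossed_rep theta a).
Proof.
split; last by exists (support_const s * M); exact: opnorm_crossed_rep.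
move=> c xi eta; apply: L2_eqP => xk.
by rewrite L2_addE L2_scaleE !crossed_rep_val -(crossed_formula_lin _ _ _ _ sa).
Qed.

End Bounded.

(** [Ma] and [Mb] only ensure that [toL2] does not take its default value on either term; the norm
    is governed by [M]. *)
Lemma opnorm_crossed_repB a b s M Ma Mb :
  (forall g, g \notin s -> a g = 0) -> (forall g, g \notin s -> b g = 0) ->
  (forall g y, Normc.normc (a g y) <= Ma) ->
  (forall g y, Normc.normc (b g y) <= Mb) ->
  (forall g y, Normc.normc (a g y - b g y) <= M) ->
  opnorm_le (fun xi : L2 R (X * U)%type =>
      crossed_rep theta a xi - crossed_rep theta b xi)
    (support_const s * M).
Proof.
move=> sa sb aMa bMb abM xi.
have sab g : g \notin s -> (fun y => a g y - b g y) = 0.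
  by move=> gs; apply/funext => z; rewrite sa // sb // subrr.
suff -> : crossed_rep theta a xi - crossed_rep theta b xi =
    crossed_rep theta (fun g y => a g y - b g y) xi.
  exact: (opnorm_crossed_rep sab abM).
apply: L2_eqP => xk; rewrite L2_addE L2_oppE.
rewrite (crossed_rep_val sa aMa) (crossed_rep_val sb bMb).
by rewrite (crossed_rep_val sab abM) (crossed_formulaB _ _ sa sb).
Qed.

Lemma crossed_support a : algebraic_crossed_product theta a ->
  exists s : {fset U}, forall g, g \notin s -> a g = 0.
Proof.
move=> [fa _]; exists (fset_set [set g | a g != 0]) => g.
rewrite in_fset_set // => gs; apply/eqP; apply: contraNT gs => ag.
exact: mem_set.
Qed.

Lemma crossed_bounded a : algebraic_crossed_product theta a ->
  exists M, forall g y, Normc.normc (a g y) <= M.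
Proof.
move=> aa; have [s sa] := crossed_support aa; case: aa => _ aC.
have {}aC g : exists M, forall y, Normc.normc (a g y) <= M.
  exact/C0_bounded/(proj1 (aC g)).
pose M g := projT1 (cid (aC g)).
have MP g y : Normc.normc (a g y) <= M g by rewrite /M; case: cid.
have M0 g : 0 <= Num.max 0 (M g) by rewrite le_max lexx.
exists (\sum_(g <- s) Num.max 0 (M g)) => g y.
have [gs|gs] := boolP (g \in s); last first.
  by rewrite sa // Normc.normc0 sumr_ge0.
rewrite (big_fsetD1 g) //=; apply: (@le_trans _ _ (Num.max 0 (M g))).
  by rewrite le_max MP orbT.
by rewrite lerDl sumr_ge0.
Qed.

Lemma crossed_coefE (f : T -> R[i]^o) (p : T) :
  crossed_coef f (telt p) (trng p) = f p.
Proof.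
rewrite /crossed_coef.
rewrite (_ : [set _ | _] = [set p]) ?fsbig_set1 //; apply/seteqP; split.
  move=> q /= [qp h]; apply: arrow_inj => //.
  apply: (@pa_fun _ _ _ theta_pa (telt p)^-1%g (trng p)).
    exact/pa_inv.
  by apply/pa_inv => //; exact: trngP.
by move=> _ ->; split=> //; exact: trngP.
Qed.

Lemma crossed_coef_out (f : T -> R[i]^o) g y : ~ pim (theta g) y ->
  crossed_coef f g y = 0.
Proof.
move=> ny; rewrite /crossed_coef fsbig1 // => p [_ h].
by case: ny; exists (tsrc p).
Qed.

Hypothesis hausX : hausdorff_space X.

(** Compact support leaves finitely many group elements, and for each [g] the coefficient is
    supported in the compact set [Kg] of ranges. Hausdorffness makes [Kg] closed, so that the
    extension by zero from im(theta_g) to all of [X] is continuous. *)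
Lemma crossed_coef_alg (f : T -> R[i]^o) : Cc f ->
  algebraic_crossed_product theta (crossed_coef f).
Proof.
move=> [fc Kc]; set K := closure _ in Kc.
have fK p : f p != 0 -> K p by move=> h; exact: subset_closure.
have supp g y : crossed_coef f g y != 0 ->
    exists p, [/\ telt p = g, trng p = y & K p].
  move=> gy; have [[x gxy]|ny] := pselect (pim (theta g) y); last first.
    by move: gy; rewrite crossed_coef_out ?eqxx.
  have [p [pg px py]] := arrow_exists theta_pa gxy.
  by exists p; split=> //; apply: fK; rewrite -crossed_coefE pg py.
split.
  apply: sub_finite_set (compact_telt Kc) => g /= gf.
  have [y gy] : exists y, crossed_coef f g y != 0.
    apply: contrapT => ny; move/eqP: gf; apply; apply/funext => y.
    by apply: contrapT => /eqP h; case: ny; exists y.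
  by have [p [pg _ Kp]] := supp _ _ gy; exists p.
move=> g; split; last exact: crossed_coef_out.
pose Kg := trng @` (K `&` [set p : T | telt p = g]).
have Kgc : compact Kg.
  apply: continuous_compact; first exact/continuous_subspaceT/trng_continuous.
  apply: (subclosed_compact _ Kc); last by move=> p [].
  by apply: closedI; [exact: closed_closure|exact: closed_telt].
have outKg y : ~ Kg y -> crossed_coef f g y = 0.
  move=> ny; apply/eqP; apply: contrapT => /negP /supp[p [pg py Kp]].
  by apply: ny; exists p.
split; last first.
  by move=> e e0; exists Kg => // y /outKg ->; rewrite Normc.normc0.
move=> y W Wy; have [[p [Kp pg] py]|ny] := pselect (Kg y); last first.
  have : nbhs y (~` Kg).
    apply: open_nbhs_nbhs; split=> //.
    by apply: closed_openC; exact: compact_closed.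
  apply: filterS => z /outKg fz; rewrite /preimage /= fz -(outKg _ ny).
  exact: nbhs_singleton.
move: Wy; rewrite -py -pg crossed_coefE => /fc /nbhs_arrow[V [oV Vp VW]].
have : nbhs (trng p) (ppreim (theta (telt p)^-1%g) V).
  apply: open_nbhs_nbhs; split; first exact: pa_open.
  by exists (tsrc p) => //; apply/pa_inv => //; exact: trngP.
apply: filterS => z [x Vx /(pa_inv theta_pa) h].
have [q [qg qx qz]] := arrow_exists theta_pa h.
by rewrite /preimage /= -qz -qg crossed_coefE; apply: VW; rewrite // qx.
Qed.

(** Each coefficient is cut off at level [d]. The support of the result lies in the set |a_g| >= d,
    a finite union over [s] of fibres over compact sets; these lie in im(theta_g), as
    [compact_fiber] requires, because a_g is 0 elsewhere. *)
Lemma crossed_coef_approx a : algebraic_crossed_product theta a ->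
  forall e, 0 < e -> exists2 f : T -> R[i]^o, Cc f &
    opnorm_le (fun xi : L2 R (X * U)%type => crossed_rep theta a xi -
                         crossed_rep theta (crossed_coef f) xi) e.
Proof.
move=> aa e e0; have [s sa] := crossed_support aa.
have [Ma aMa] := crossed_bounded aa.
(* The cutoff moves coefficients by at most [2 * d], so the error is at most
   [support_const s * (2 * d)]; the added 1 covers an empty [s]. *)
pose d := e / (2 * (support_const s + 1)).
have s0 : 0 <= support_const s by rewrite ler0n.
have d0 : 0 < d by rewrite divr_gt0 // mulr_gt0 // ltr_wpDl.
pose b g y := cutoff d (a g y).
pose f (p : T) := b (telt p) (trng p).
have bE : crossed_coef f = b.
  apply/funext => g; apply/funext => y.
  have [[x gxy]|ny] := pselect (pim (theta g) y).
    by have [p [<- _ <-]] := arrow_exists theta_pa gxy; rewrite crossed_coefE.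
  rewrite crossed_coef_out // /b; case: aa => _ /(_ g)[_ ->] //.
  by rewrite cutoff0.
have ac g : continuous (a g) by case: aa => _ /(_ g)[[]].
have fCc : Cc f.
  split.
    apply: (fiberwise_continuous theta_pa) => g y.
    exact: continuous_comp (ac g y) (@cutoff_continuous R d (a g y)).
  pose D := [set p : T | d <= Normc.normc (a (telt p) (trng p))].
  have Dclosed : closed D.
    have h : continuous (fun p : T => Normc.normc (a (telt p) (trng p)) : R^o).
      apply: (@fiberwise_continuous _ _ _ theta_pa _
        (fun g y => Normc.normc (a g y) : R^o)) => g y.
      exact: continuous_comp (ac g y) (@normc_continuous R (a g y)).
    apply: (@preimage_closed _ _ _ [set r : R^o | d <= r]);
      last exact: closed_ge.
    by move=> p _; exact: h.
  have Dcompact : compact D.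
    pose Ka g := [set y | d <= Normc.normc (a g y)].
    have -> : D =
        \big[setU/set0]_(g <- s) [set p : T | telt p = g /\ Ka g (trng p)].
      rewrite -bigcup_seq; apply/seteqP; split=> [p Dp|p [g _ [<-]] //].
      exists (telt p) => //=; apply/negPn/negP => /sa ap.
      by move: Dp; rewrite /D /= ap Normc.normc0 leNgt d0.
    apply: bigsetU_compact => g _; apply: compact_fiber => //.
      case: aa => _ /(_ g)[[_ /(_ _ d0)[K Kc aK]] _].
      apply: (subclosed_compact _ Kc) => [|y]; rewrite /Ka /=; last first.
        by rewrite leNgt => /negP; apply: contra_notP => /aK.
      apply: (@preimage_closed _ _ _ [set r : R^o | d <= r]);
        last exact: closed_ge.
      move=> y _; exact: continuous_comp (ac g y) (@normc_continuous R (a g y)).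
    move=> y; rewrite /Ka /= => dy; apply: contrapT => ny.
    case: aa => _ /(_ g)[_ /(_ _ ny) ay].
    by move: dy; rewrite ay Normc.normc0 leNgt d0.
  apply: (subclosed_compact _ Dcompact); first exact: closed_closure.
  rewrite (iffLR (closure_id _) Dclosed); apply: closureS => p /=.
  exact: cutoff_supp.
exists f => //; rewrite bE => xi.
have sb g : g \notin s -> b g = 0.
  by move=> /sa ag; apply/funext => y; rewrite /b ag cutoff0.
have [Mb bMb] : exists M, forall g y, Normc.normc (b g y) <= M.
  by rewrite -bE; apply: crossed_bounded; exact: crossed_coef_alg.
have abd g y : Normc.normc (a g y - b g y) <= 2 * d.
  by rewrite normc_distC; exact: cutoff_near.
apply: le_trans (opnorm_crossed_repB sa sb aMa bMb abd xi) _.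
apply: ler_wpM2r; first exact: l2norm_ge0.
rewrite mulrA [_ * 2]mulrC /d mulrA ler_pdivrMr ?mulr_gt0 // ?ltr_wpDl //.
by move: (support_const s) => S; lra.
Qed.

End CrossedFormula.

Lemma Cc_comp_homeo (R : realType) (X : Type) (G H : topGroupoid X) (F : G -> H)
    (F' : H -> G) (f : H -> R[i]^o) :
  continuous F -> continuous F' -> cancel F F' -> cancel F' F ->
  Cc f -> Cc (f \o F).
Proof.
move=> Fc F'c FK F'K [fc Kc]; split.
  by move=> x; exact: continuous_comp (Fc x) (fc (F x)).
pose K := F' @` closure [set a | f a != 0].
have KE : K = F @^-1` closure [set a | f a != 0].
  apply/seteqP; split=> [_ [y Ky <-]|x Kx]; first by rewrite /preimage /= F'K.
  by exists (F x).
have Kcompact : compact K.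
  by apply: continuous_compact => //; exact: continuous_subspaceT.
apply: (subclosed_compact _ Kcompact); first exact: closed_closure.
have Kclosed : closed K.
  rewrite KE; apply: preimage_closed; last exact: closed_closure.
  by move=> x _; exact: Fc.
rewrite (iffLR (closure_id _) Kclosed); apply: closureS => x fx.
by rewrite KE; apply: subset_closure.
Qed.

(** * From isomorphisms of topological groupoids to *-isomorphisms *)

Section InducedIsomorphism.
Variables (R : realType) (U : groupType) (X : topologicalType).
Variables (theta : U -> set (X * X)) (G : topGroupoid X).
Local Notation T := (transformation_groupoid theta).
Variable F : G -> T.
Hypothesis theta_pa : is_partial_action theta.
Hypothesis hausX : hausdorff_space X.
Hypothesis F_iso : is_groupoid_iso F.

Definition arrow_code (a : G) : (X * U)%type := (tsrc (F a), telt (F a)).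

Lemma iso_inj : injective F.
Proof. by case: F_iso => _ [F' [FK _ _]] _ _ _; exact: can_inj FK. Qed.

Lemma iso_surj p : exists a, F a = p.
Proof. by case: F_iso => _ [F' [_ F'K _]] _ _ _; exists (F' p). Qed.

Lemma arrow_code_inj : injective arrow_code.
Proof. by move=> a b [e1 e2]; apply: iso_inj; apply: arrow_inj. Qed.

(** For an arrow c = (x, k) with range y, the factorisations c = ab correspond to the g with y in
    im(theta_g): a is the arrow over g with range y, and b = (x, g^-1 k). *)
Lemma crossed_formula_convolution (f : T -> R[i]^o) (xi : X * U -> R[i]^o) :
  crossed_formula theta (crossed_coef f) xi =
  extend0 arrow_code (convolution (f \o F) (xi \o arrow_code)).
Proof.
apply/funext => -[x k]; have [[y kxy]|nk] := pselect (exists y, theta k (x, y));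
    last first.
  rewrite crossed_formula_out => [|y kxy]; last by case: nk; exists y.
  rewrite extend0_out // => a [ax ak]; apply: nk.
  by exists (trng (F a)); rewrite -ax -ak; exact: trngP.
have [q [qk qx qy]] := arrow_exists theta_pa kxy; have [c cq] := iso_surj q.
have xkE : (x, k) = arrow_code c by rewrite /arrow_code cq qk qx.
rewrite (crossed_formulaE theta_pa _ _ kxy) xkE extend0E; last first.
  exact: arrow_code_inj.
have mulE a b : gmul a b c -> [/\ theta (telt (F b)) (x, tsrc (F a)),
    tsrc (F b) = x, telt (F b) = ((telt (F a))^-1 * k)%g & trng (F a) = y].
  case: F_iso => _ _ _ _ /(_ a b c) [_ h] /h [/= h1]; rewrite cq => h2.
  have e1 : k = (telt (F a) * telt (F b))%g by rewrite -qk /telt h2.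
  have e2 : tsrc (F b) = x by rewrite -qx /tsrc h2.
  split=> //; [by rewrite -e2|by rewrite e1 mulKg|].
  apply: (@pa_fun _ _ _ theta_pa k x) => //; rewrite e1.
  apply: (pa_comp theta_pa _ (trngP _)).
  by rewrite -e2.
pose P : set (G * G) := [set ab | gmul ab.1 ab.2 c].
pose Q := [set g | pim (theta g) y].
(* The coefficient vanishes at [y] for the remaining [g], which come from no factorisation. *)
rewrite -(@fsbig_widen _ _ _ _ Q); last 2 first.
- by [].
- by move=> g [_ ny]; rewrite /preimage /= crossed_coef_out ?mul0r.
rewrite (@reindex_fsbig _ _ _ _ _ (fun ab => telt (F ab.1)) P) /=; last first.
  split.
  - move=> [a b] /mulE[_ _ _ /= ay]; exists (tsrc (F a)).
    rewrite -ay; exact: trngP.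
  - move=> [a b] [a' b'] /set_mem/mulE[h1 h2 h3 _].
    move=> /set_mem/mulE[h1' h2' h3' _] /= e.
    have bb' : b = b'.
      by apply: iso_inj; apply: arrow_inj; rewrite ?h2 ?h2' // h3 h3' e.
    rewrite bb' in h1 *; congr (_, _); apply: iso_inj; apply: arrow_inj => //.
    exact: (pa_fun theta_pa h1 h1').
  - move=> g [w gwy]; have [p [pg pw py]] := arrow_exists theta_pa gwy.
    have xw := pa_comp theta_pa kxy (iffRL (pa_inv theta_pa g y w) gwy).
    have [p' [pg' pw' py']] := arrow_exists theta_pa xw.
    have [a ap] := iso_surj p; have [b bp] := iso_surj p'.
    exists (a, b) => /=; last by rewrite ap.
    case: F_iso => _ _ _ _ /(_ a b c) [h _]; apply: h; rewrite ap bp cq.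
    by rewrite /= !arrow_pair /= qk qx pg pg' pw pw' mulVKg.
apply: eq_fsbigr => -[a b] /set_mem/mulE[_ h2 h3 h4] /=.
by rewrite -h4 crossed_coefE // /arrow_code /= h2 h3.
Qed.

Lemma corner_regular_rep (f : T -> R[i]^o) :
  corner arrow_code_inj (regular_rep (f \o F)) =
  crossed_rep theta (crossed_coef f).
Proof.
apply/funext => xi; rewrite /corner /regular_rep /crossed_rep.
by rewrite crossed_formula_convolution (toL2_extend0 arrow_code_inj).
Qed.

(** The two inclusions differ: the corner of a generator is exactly a generator of the crossed
    product, while a generator of the crossed product is only a norm limit of such corners. *)
Lemma iso_induces_star_iso : induces_star_iso R F.
Proof.
have [Fc [F' [FK F'K F'c]] _ _ _] := F_iso.
have CcF (f : T -> R[i]^o) : Cc f -> Cc (f \o F).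
  exact: Cc_comp_homeo Fc F'c FK F'K.
exists (corner arrow_code_inj); last by move=> f _; exact: corner_regular_rep.
apply: corner_star_iso.
  move=> _ [f fCc <-].
  have {1}-> : f = (f \o F') \o F by apply/funext => a /=; rewrite FK.
  rewrite corner_regular_rep.
  have aa := crossed_coef_alg theta_pa hausX (Cc_comp_homeo F'c Fc F'K FK fCc).
  have [s sa] := crossed_support aa; have [M aM] := crossed_bounded aa.
  split; first exact: crossed_rep_bounded sa aM.
  move=> e e0; exists (crossed_rep theta (crossed_coef (f \o F'))).
    by exists (crossed_coef (f \o F')).
  by move=> xi; rewrite subrr l2norm0 mulr_ge0 ?l2norm_ge0 // ltW.
move=> _ [a aa <-].
have [s sa] := crossed_support aa; have [M aM] := crossed_bounded aa.
split; first exact: crossed_rep_bounded sa aM.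
move=> e e0; have [f fCc fe] := crossed_coef_approx theta_pa hausX aa e0.
exists (crossed_rep theta (crossed_coef f)) => //.
exists (regular_rep (f \o F)); last exact: corner_regular_rep.
by exists (f \o F) => //; exact: CcF.
Qed.

End InducedIsomorphism.

(** * Germs as arrows of the transformation groupoid *)

Section GermIsomorphism.
Variables (C : category) (G : groupoid) (rho : C -> G).
Variables (U : groupType) (j : G -> U).
Hypothesis rho_emb : is_embedding rho.
Hypothesis jU : is_universal_group j.
Implicit Types (s t : set (C * C)) (chi : Omega C).

Local Notation rb := (rhobar rho j).
Local Notation theta := (canonical_action rho j).
Local Notation T := (transformation_groupoid theta).

Let cancelC : left_cancellative C := embedded_left_cancellative rho_emb jU.
Let theta_pa : is_partial_action theta := canonical_action_partial rho_emb jU.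

(** Quantifying over all representatives records independence of the choice of [s], which holds
    since equal germs share a pair and hence a translating element. *)
Lemma arrow_of_germ (a : germ_groupoid C) : exists p : T,
  forall s chi, is_germ s chi a -> set_val p = (rb s, chi).
Proof.
have [s [chi sa]] := germP a; have [ss sd _] := sa.
have [psi e] := act_OmegaP rho_emb jU ss sd.
have [p [p1 p2 _]] :
    exists p : T, [/\ telt p = rb s, tsrc p = chi & trng p = psi].
  by apply: (arrow_exists theta_pa); apply/(canonical_actionE rho_emb jU).
exists p => t phi ta; have [cp st] := is_germ_eq sa ta.
have [tt _ _] := ta.
by rewrite -cp -(germ_eq_rhobar rho_emb jU ss tt st) arrow_pair p1 p2.
Qed.

Definition germ_map (a : germ_groupoid C) : T := projT1 (cid (arrow_of_germ a)).

Lemma germ_mapE s chi (a : germ_groupoid C) : is_germ s chi a ->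
  set_val (germ_map a) = (rb s, chi).
Proof. by rewrite /germ_map; case: cid => p /= h; exact: h. Qed.

Lemma germ_map_inj : injective germ_map.
Proof.
move=> a b ab; have [s [chi sa]] := germP a; have [t [psi tb]] := germP b.
have := germ_mapE tb; rewrite -ab (germ_mapE sa) => -[st cp].
rewrite -cp in tb; have [[ss sd _] [tt td _]] := (sa, tb).
exact: (is_germ_inj cancelC sa tb (rhobar_eq_germ rho_emb jU ss tt sd td st)).
Qed.

Lemma germ_map_surj p : exists a, germ_map a = p.
Proof.
have [psi [s [ss e /= sd _]]] := trng_subproof p.
have [a sa] := germ_exists ss sd; exists a; apply: val_inj.
by rewrite [LHS](germ_mapE sa) e [RHS]surjective_pairing.
Qed.

Lemma germ_map_continuous : continuous germ_map.
Proof.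
move=> a A /nbhs_arrow[V [oV Va VA]].
have [s [chi sa]] := germP a; have [ss sd _] := sa; have ae := germ_mapE sa.
have Vchi : V chi by move: Va; rewrite /tsrc ae.
have [W [oW cW Wchi WV Ws]] :=
  Omega_basis cancelC (open_nbhs_nbhs (conj oV Vchi)) sd.
have nW : nbhs a (@germ_subbase C (s, W)).
  apply: open_nbhs_nbhs; split; first exact: germ_subbase_open.
  by exists chi.
apply: filterS nW => b [psi /= Wpsi sb]; apply: VA.
  by rewrite /telt (germ_mapE sb) ae.
by rewrite /tsrc (germ_mapE sb); exact: WV.
Qed.

Lemma germ_map_iso : is_groupoid_iso germ_map.
Proof.
split.
- exact: germ_map_continuous.
- pose F' p := projT1 (cid (germ_map_surj p)).
  have F'K p : germ_map (F' p) = p by rewrite /F'; case: cid.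
  exists F'; split=> //; first by move=> a; apply: germ_map_inj; rewrite F'K.
  apply: continuous_germ => -[s W] [/= ss oW cW Ws].
  (* The subbasic set [s, W] corresponds to {rb s} x W: an arrow over [W] with group element [rb s]
     is the image of a germ of the same [s]. *)
  rewrite openE => p [chi Wchi sp].
  have pe : set_val p = (rb s, chi) by rewrite -(F'K p) (germ_mapE sp).
  apply/nbhs_arrow; exists W; split=> //; first by rewrite /tsrc pe.
  move=> q; rewrite /telt /tsrc pe /= => q1 Wq.
  have [b sb] := germ_exists ss (Ws _ Wq).
  exists (set_val q).2 => //=; suff -> : F' q = b by [].
  apply: germ_map_inj; rewrite F'K; apply: val_inj.
  by rewrite [RHS](germ_mapE sb) [LHS]surjective_pairing q1.
- move=> a chi; split=> /= [->|[s /germ_mapE ->] //].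
  by have [s [psi sa]] := germP a; exists s; rewrite (germ_mapE sa).
- move=> a psi; split=> /= [|[s [chi [sa e]]]]; last first.
    rewrite (germ_mapE sa) /=; have [ss sd _] := sa.
    exact/(canonical_actionE rho_emb jU).
  have [s [chi sa]] := germP a; rewrite (germ_mapE sa) /=.
  have [ss sd _] := sa; move=> /(canonical_actionE rho_emb jU _ ss sd) e.
  by exists s, chi.
- move=> a b c; split=> /= [[h1 h2]|[s [t [chi [psi [tb e sa stc]]]]]].
    have [t [chi tb]] := germP b; have [tt td _] := tb.
    have [s [psi sa]] := germP a; have [ss sd _] := sa.
    move: h1 h2; rewrite (germ_mapE tb) (germ_mapE sa) /=.
    move=> /(canonical_actionE rho_emb jU _ tt td) e h2.
    exists s, t, chi, psi; split=> //.
    have st : Il (s \; t)%relation := Il_mul ss tt.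
    have std : Omega_at (pdom (s \; t)%relation) chi.
      move: sd; rewrite /Omega_at /= e supp_act //; last exact: Jset_pdom.
      by rewrite ppreim_pdom.
    have [c' stc] := germ_exists st std.
    (* Injectivity of [germ_map] identifies [c] with the germ of [st]: both have the same group
       element and source. *)
    suff -> : c = c' by [].
    apply: germ_map_inj; apply: val_inj; rewrite [LHS]h2 [RHS](germ_mapE stc).
    by rewrite (rhobar_comp rho_emb jU ss tt (Omega_at_nonempty std)).
  rewrite (germ_mapE tb) (germ_mapE sa) (germ_mapE stc) /=.
  have [ss sd _] := sa; have [tt td _] := tb; have [_ std _] := stc.
  rewrite -(rhobar_comp rho_emb jU ss tt (Omega_at_nonempty std)); split=> //.
  exact/(canonical_actionE rho_emb jU).
Qed.

(** A neighbourhood of [psi] pulls back to one of [chi], which contains a maximal character; its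
    translate is again maximal by [act_maximal]. *)
Lemma bdOmega_invariant g chi psi : theta g (chi, psi) -> bdOmega C chi ->
  bdOmega C psi.
Proof.
move=> h; have [s [ss sg /= sd e]] := h; move=> chim V.
rewrite nbhsE => -[V' [oV' V'psi] V'V].
have nW : nbhs chi (ppreim (theta g) V').
  apply: open_nbhs_nbhs; split; first exact: pa_open.
  by exists psi.
have [phi [phim [phi' V'phi' [t [tt _ /= td e']]]]] := chim _ nW.
exists phi'; split; last exact: V'V.
by rewrite /= e'; exact: act_maximal.
Qed.

End GermIsomorphism.

(** * Restriction to an invariant subset of the unit space *)

Section Restriction.
Variables (U : groupType) (X : topologicalType) (theta : U -> set (X * X)).
Variables (G : topGroupoid X) (F : G -> transformation_groupoid theta).
Variable Y : set X.
Hypothesis theta_pa : is_partial_action theta.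
Hypothesis invY : forall g x y, theta g (x, y) -> Y x -> Y y.
Hypothesis F_iso : is_groupoid_iso F.

Local Notation thetaY := (restrict_action theta Y).
Local Notation GY := (groupoid_restrict G Y).
Local Notation TY := (transformation_groupoid thetaY).

(** By invariance, a point of [Y] is moved only to points of [Y], so preimages may be computed in
    [X]; openness for the restricted action follows. *)
Lemma restrict_ppreim g (V : set X) :
  ppreim (thetaY g) (set_val @^-1` V) = set_val @^-1` (ppreim (theta g) V).
Proof.
apply/seteqP; split=> [x [y Vy xy]|x [y Vy xy]]; first by exists (set_val y).
have [y' y'E] := set_val_surj (invY xy (set_mem (valP x))).
by exists y'; rewrite /preimage /restrict_action /= y'E.
Qed.

Lemma restrict_partial_action : is_partial_action thetaY.
Proof.
have op g (V : set (set_type Y)) : open V -> open (ppreim (thetaY g) V).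
  move=> /open_set_valP[W oW ->]; rewrite restrict_ppreim.
  exact/open_set_val/pa_open.
split.
- by move=> g x y z xy xz; apply: val_inj; exact: (pa_fun theta_pa xy xz).
- case: theta_pa => _ th1 _ _ _; rewrite /restrict_action th1.
  by apply/seteqP; split=> -[x y] /= => [/val_inj|->].
- by move=> g; apply/seteqP; split=> -[x y] /= h; apply/(pa_inv theta_pa).
- by move=> g h [x z] [y /= xy yz]; exact: (pa_comp theta_pa xy yz).
- split=> [g|]; last exact: op.
  rewrite (_ : pdom _ = ppreim (thetaY g) setT); first exact/op/openT.
  by apply/seteqP; split=> x [y]; [exists y|exists y].
Qed.

Lemma restricted_arrow (a : GY) : exists p : TY,
  telt p = telt (F (set_val a)) /\ set_val (tsrc p) = tsrc (F (set_val a)).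
Proof.
have [[x Yx sx] _] := set_mem (valP a).
case: F_iso => _ _ hs _ _; have /hs xE := sx.
have [x' x'E] := set_val_surj Yx.
have h := trngP (F (set_val a)).
rewrite [tsrc _](esym xE) in h.
have [y' y'E] := set_val_surj (invY h Yx).
have h' : thetaY (telt (F (set_val a))) (x', y').
  by rewrite /restrict_action /= x'E y'E.
have [p [p1 p2 _]] := arrow_exists restrict_partial_action h'.
by exists p; rewrite p1 p2 x'E xE.
Qed.

Definition restricted_map (a : GY) : TY := projT1 (cid (restricted_arrow a)).

Lemma restricted_mapE a : telt (restricted_map a) = telt (F (set_val a)) /\
  set_val (tsrc (restricted_map a)) = tsrc (F (set_val a)).
Proof. by rewrite /restricted_map; case: cid. Qed.

Lemma restricted_map_inj : injective restricted_map.
Proof.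
move=> a b ab; have [a1 a2] := restricted_mapE a.
have [b1 b2] := restricted_mapE b.
apply: val_inj; apply: (iso_inj F_iso); apply: arrow_inj.
  by rewrite -a1 -b1 ab.
by rewrite -a2 -b2 ab.
Qed.

Lemma restricted_map_surj p : exists a, restricted_map a = p.
Proof.
have h : theta (telt p) (set_val (tsrc p), set_val (trng p)).
  exact: (trngP p).
have [q [q1 q2 q3]] := arrow_exists theta_pa h.
have [a aq] := iso_surj F_iso q.
have [a' a'E] : exists a' : GY, set_val a' = a.
  apply: set_val_surj; case: F_iso => _ _ hs hr _; split.
    exists (set_val (tsrc p)); first exact: (set_mem (valP (tsrc p))).
    by apply/hs; rewrite aq /= -q2.
  exists (set_val (trng p)).
    exact: (set_mem (valP (trng p))).
  by apply/hr; rewrite aq /= arrow_pair q1 q2.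
exists a'; have [h1 h2] := restricted_mapE a'; apply: arrow_inj.
  by rewrite h1 a'E aq q1.
by apply: val_inj; rewrite [LHS]h2 a'E aq q2.
Qed.

(** The topology of [TY] comes from U x Y, that of [GY] from the arrows of [G]; [nbhs_arrow] and
    [nbhs_set_val] reduce both to open sets upstairs, where [F] and its inverse are continuous. *)
Lemma restricted_map_iso : is_groupoid_iso restricted_map.
Proof.
case: (F_iso) => Fc [F0 [FK F0K F0c]] hs hr hm; split.
- move=> a A /nbhs_arrow[_ [/open_set_valP[V oV ->] Va VA]].
  have [a1 a2] := restricted_mapE a.
  have nA : nbhs (F (set_val a))
      [set q | telt q = telt (F (set_val a)) /\ V (tsrc q)].
    apply/nbhs_arrow; by exists V; split=> //; rewrite -a2.
  have := Fc (set_val a) _ nA; rewrite nbhs_simpl /= nbhsE => -[B [oB Ba] BF].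
  apply/nbhs_set_val; exists B; split=> // b /BF[/= b1 Vb].
  have [h1 h2] := restricted_mapE b; apply: VA; first by rewrite h1 b1 a1.
  by rewrite /preimage /= h2.
- pose F' p := projT1 (cid (restricted_map_surj p)).
  have F'K p : restricted_map (F' p) = p by rewrite /F'; case: cid.
  exists F'; split=> //.
    by move=> a; apply: restricted_map_inj; rewrite F'K.
  move=> p A /nbhs_set_val[B [oB Bp BA]].
  have [p1 p2] := restricted_mapE (F' p).
  have nB : nbhs (F (set_val (F' p))) (F0 @^-1` B).
    apply: F0c; rewrite FK; exact: open_nbhs_nbhs.
  have [V [oV Vp VB]] := iffLR (nbhs_arrow _ _) nB.
  apply/nbhs_arrow; exists (set_val @^-1` V); split.
  + exact: open_set_val.
  + by rewrite /preimage /= -[p in tsrc p]F'K p2.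
  + move=> q q1 Vq; apply: BA; rewrite -[set_val _]FK; apply: VB.
      by have [<- _] := restricted_mapE (F' q); rewrite F'K q1 -p1 F'K.
    by have [_ <-] := restricted_mapE (F' q); rewrite F'K.
- move=> a x; have [_ h2] := restricted_mapE a; split=> /= [->|/hs xE].
    by apply/hs => /=; exact: h2.
  by apply: val_inj; rewrite [LHS]xE [RHS]h2.
- move=> a x; have [h1 h2] := restricted_mapE a.
  by rewrite /= -hr /restrict_action /= !arrow_pair /= h1 h2.
- move=> a b c; have [a1 a2] := restricted_mapE a.
  have [b1 b2] := restricted_mapE b; have [c1 c2] := restricted_mapE c.
  rewrite /= -hm /= /restrict_action /=.
  rewrite !arrow_pair /= -a1 -a2 -b1 -b2 -c1 -c2.
  split=> -[h1 h2]; split=> //; first by case: h2 => -> ->.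
  by case: h2 => -> /val_inj ->.
Qed.

End Restriction.

Theorem corollary4p16 (R : realType) (C : category) (G : groupoid)
    (rho : C -> G) (U : groupType) (j : G -> U) :
  is_embedding rho -> is_universal_group j ->
  exists (rb : set (C * C) -> U) (theta : U -> set (Omega C * Omega C)),
    [/\ is_rhobar rho j rb,
        is_canonical_action rb theta,
        exists F : germ_groupoid C -> transformation_groupoid theta,
          [/\ forall s chi (a : germ_groupoid C),
                is_germ s chi a -> set_val (F a) = (rb s, chi),
              is_groupoid_iso F
            & induces_star_iso R F],
        is_partial_action (restrict_action theta (bdOmega C))
      & exists F : groupoid_restrict (germ_groupoid C) (bdOmega C) ->
            transformation_groupoid (restrict_action theta (bdOmega C)),
          [/\ forall s (chi : set_type (bdOmega C))
                  (a : groupoid_restrict (germ_groupoid C) (bdOmega C)),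
                is_germ s (set_val chi) (set_val a) ->
                set_val (F a) = (rb s, chi),
              is_groupoid_iso F
            & induces_star_iso R F]].
Proof.
move=> rho_emb jU; exists (rhobar rho j), (canonical_action rho j).
have theta_pa := canonical_action_partial rho_emb jU.
have hausO := @Omega_hausdorff C.
have F_iso := germ_map_iso rho_emb jU.
have inv := bdOmega_invariant rho_emb jU.
have thetaY_pa := restrict_partial_action theta_pa inv.
have FY_iso := restricted_map_iso theta_pa inv F_iso.
split=> //.
- exact: rhobarP.
- exact: canonical_actionP.
- exists (germ_map rho_emb jU); split=> //; first exact: germ_mapE.
  exact: iso_induces_star_iso.
- exists (restricted_map theta_pa inv F_iso); split=> //.
    move=> s chi a sa; have [h1 h2] := restricted_mapE theta_pa inv F_iso a.
    have ae := germ_mapE rho_emb jU sa.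
    rewrite /telt /tsrc ae /= in h1 h2.
    by rewrite [LHS]surjective_pairing h1; congr pair; exact: val_inj.
  by apply: iso_induces_star_iso => //; exact: set_type_hausdorff.
Qed.
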